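(* Let $\mathcal{E}=(\mathcal{U},\tilde\varphi,\mathcal{J})$ be an exchangeability system for a noncommutative probability space $(\mathcal{A},\varphi)$ with faithful state $\tilde\varphi$ such that both weak freeness and the weak singleton condition hold. Then crossing cumulants vanish, i.e. $K^{\mathcal{E}}_\pi(X_1,\dots,X_n)=0$ for all $n$, all $X_1,\dots,X_n\in\mathcal{A}$ and every partition $\pi\in\Pi_n$ which is not noncrossing. In particular, $\mathcal{E}$ can be embedded into an amalgamated free product.
   Context: All algebras are unital complex $C^*$- or pre-$C^*$-algebras. A noncommutative probability space is a pair $(\mathcal{A},\varphi)$ of such an algebra and a state $\varphi$ on it. Exchangeability system. An exchangeability system $\mathcal{E}=(\mathcal{U},\tilde\varphi,\mathcal{J})$ for $(\mathcal{A},\varphi)$ consists of a noncommutative probability space $(\mathcal{U},\tilde\varphi)$ and an infinite family $\mathcal{J}=(\iota_k)_{k\in\mathbf{N}}$ of state-preserving embeddings ($*$-homomorphisms with $\tilde\varphi\circ\iota_k=\varphi$) $\iota_k:\mathcal{A}\to\mathcal{A}_k\subseteq\mathcal{U}$, written $X\mapsto X^{(k)}$, such that for all $n$, $X_1,\dots,X_n\in\mathcal{A}$, $h:[n]\to\mathbf{N}$ (where $[n]=\{1,\dots,n\}$) and $\sigma\in\mathfrak{S}_\infty$ (permutations of $\mathbf{N}$) $$\tilde\varphi(X_1^{(h(1))}\cdots X_n^{(h(n))})=\tilde\varphi(X_1^{(\sigma(h(1)))}\cdots X_n^{(\sigma(h(n)))}).$$ It is assumed that $\mathcal{U}$ is generated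 by the algebras $\mathcal{A}_k$ and that the action $\sigma(X^{(k)})=X^{(\sigma(k))}$ of $\mathfrak{S}_\infty$ extends to all of $\mathcal{U}$ leaving $\tilde\varphi$ invariant. Cumulants. $\Pi_n$ is the lattice of set partitions of $[n]$ ($\pi\le\sigma$ means $\pi$ is finer than $\sigma$), with Möbius function $\mu$. For $\pi\in\Pi_n$, $\varphi_\pi(X_1,\dots,X_n)=\tilde\varphi(X_1^{(\pi(1))}\cdots X_n^{(\pi(n))})$, where $\pi(i)$ is the number of the block of $\pi$ containing $i$ (the numbering of the blocks is irrelevant), and $K^{\mathcal{E}}_\pi(X_1,\dots,X_n)=\sum_{\sigma\le\pi}\varphi_\sigma(X_1,\dots,X_n)\,\mu(\sigma,\pi)$. A partition is noncrossing if there are no $i<j<k<l$ with $i\sim k$, $j\sim l$, $i\not\sim j$. Weak singleton condition. For all $n$, $X_1,\dots,X_n\in\mathcal{A}$ and indices $i_1,\dots,i_n\in\mathbf{N}$: $\tilde\varphi(X_1^{(i_1)}\cdots X_n^{(i_n)})=0$ whenever, for some $j$, the index $i_j$ appears only once among $i_1,\dots,i_n$ and $\tilde\varphi((X_j^{(1)})^*X_j^{(2)})=0$. Weak freeness. For $I\subseteq\mathbf{N}$ let $\mathcal{A}_I$ be the subalgebra of $\mathcal{U}$ generated by $(\mathcal{A}_i)_{i\in I}$. $\mathcal{E}$ satisfies weak freeness if $\tilde\varphi(X_1X_2\cdots X_n)=0$ whenever $(I_k)$ are disjoint index sets, $X_j\in\mathcal{A}_{I_{i_j}}$ with $i_j\ne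 i_{j+1}$ for every $1\le j\le n-1$, and $\tilde\varphi((X_j^{(1)})^*X_j^{(2)})=0$ for every $j$; here $X_j^{(1)}$ and $X_j^{(2)}$ are the copies of $X_j$ in $\mathcal{A}_{I'}$ and $\mathcal{A}_{I''}$, where $I',I''\subseteq\mathbf{N}$ are disjoint copies of $I_{i_j}$ (the copies of $X_j$ being its images under the permutation isomorphisms induced by bijections $I_{i_j}\to I'$, $I_{i_j}\to I''$). Embedding. A conditional expectation from a unital algebra onto a unital subalgebra $\mathcal{B}$ is a unital positive map $\psi$ onto $\mathcal{B}$ with $\psi(BXB')=B\psi(X)B'$ for $B,B'\in\mathcal{B}$. ''$\mathcal{E}$ can be embedded into an amalgamated free product'' means: there are an algebra $\tilde{\mathcal{U}}$, a conditional expectation $\psi:\tilde{\mathcal{U}}\to\mathcal{B}$ onto a subalgebra $\mathcal{B}$, an injective $*$-homomorphism of $\mathcal{U}$ into $\tilde{\mathcal{U}}$ (through which $\mathcal{U}$ and the elements $X^{(k)}$ are regarded as contained in $\tilde{\mathcal{U}}$), and a state on $\mathcal{B}$ whose composition with $\psi$ restricts to $\tilde\varphi$ on $\mathcal{U}$, such that the algebras $\mathcal{A}_i$ are interchangeable with respect to $\psi$ (i.e. $\psi(X_1^{(h(1))}\cdots X_n^{(h(n))})=\psi(X_1^{(\sigma(h(1)))}\cdots X_n^{(\sigma(h(n)))})$ for all $X_j\in\mathcal{A}$, $h:[n]\to\mathbf{N}$, $\sigma\in\mathfrak{S}_\infty$) and free with amalgamation over $\mathcal{B}$ (i.e. $\psi(X_1^{(h(1))}\cdots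 X_n^{(h(n))})=0$ whenever $X_j\in\mathcal{A}$ with $\psi(X_j^{(1)})=0$ for all $j$ and $h(j)\ne h(j+1)$ for $1\le j\le n-1$). *)

(* Defs.v *)
From HB Require Import structures.
From mathcomp Require Import all_boot all_order all_algebra.

Set Implicit Arguments.
Unset Strict Implicit.
Unset Printing Implicit Defensive.

Import Order.TTheory GRing.Theory Num.Theory.

Local Open Scope ring_scope.

(* The recursion is over an upper bound [k] on the length of chains between
   [x] and [y]; the size of the poset is such a bound (see [moebiusE]). *)
Fixpoint moebius_rec d (T : finPOrderType d) (k : nat) (x y : T) : int :=
  if k is k'.+1 then
    if x == y then 1
    else if (x <= y)%O
         then - \sum_(z | (x <= z)%O && (z < y)%O) moebius_rec k' x z
         else 0
  else 0.

Definition moebius d (T : finPOrderType d) (x y : T) : int :=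
  moebius_rec #|T| x y.

Section MoebiusTheory.
Context d (T : finPOrderType d).
Implicit Types x y z : T.

Lemma moebius_rec_stable k1 k2 x y :
  (#|[pred z | (x <= z)%O && (z <= y)%O]| <= k1)%N ->
  (#|[pred z | (x <= z)%O && (z <= y)%O]| <= k2)%N ->
  moebius_rec k1 x y = moebius_rec k2 x y.
Proof.
have empty u v : (#|[pred z : T | (u <= z)%O && (z <= v)%O]| <= 0)%N ->
    (u <= v)%O = false.
  rewrite leqn0 => /eqP /card0_eq uv0; apply/negP => uv.
  by have := uv0 u; rewrite !inE lexx uv.
have rec0 k u v : (u <= v)%O = false -> moebius_rec k u v = 0.
  case: k => [//|k] uv /=.
  by case: eqP uv => [->|_ ->//]; rewrite lexx.
elim: k1 k2 y => [|k1 IH] [|k2] y h1 h2 //.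
- by rewrite [RHS]rec0 // empty.
- by rewrite [LHS]rec0 // empty.
rewrite /=; case: ifP => // _; case: ifP => // xy.
congr (- _); apply: eq_bigr => z /andP[xz zy].
have lt : (#|[pred w | (x <= w)%O && (w <= z)%O]|
          < #|[pred w | (x <= w)%O && (w <= y)%O]|)%N.
  apply/proper_card/properP; split.
    apply/subsetP => w; rewrite !inE => /andP[-> wz] /=.
    exact: le_trans wz (ltW zy).
  by exists y; rewrite !inE xy ?lexx ?(lt_geF zy).
by apply: IH; rewrite -ltnS; [exact: leq_trans lt h1|exact: leq_trans lt h2].
Qed.

Lemma moebiusE x y :
  moebius x y =
    if x == y then 1
    else if (x <= y)%O
         then - \sum_(z | (x <= z)%O && (z < y)%O) moebius x z
         else 0.
Proof.
rewrite /moebius.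
rewrite (@moebius_rec_stable _ #|T|.+1); last 2 first.
- exact: max_card.
- exact: leq_trans (max_card _) (leqnSn _).
by [].
Qed.

End MoebiusTheory.

Record setpart (n : nat) := SetPart {
  blocks :> {set {set 'I_n}};
  blocksP : partition blocks [set: 'I_n]
}.

HB.instance Definition _ n := [isSub of setpart n for @blocks n].
HB.instance Definition _ n := [Finite of setpart n by <:].

Definition finer n (P Q : setpart n) : bool :=
  [forall B in blocks P, [exists C in blocks Q, B \subset C]].

Lemma finer_refl n : reflexive (@finer n).
Proof.
by move=> P; apply/forall_inP => B BP; apply/exists_inP; exists B.
Qed.

Lemma finer_trans n : transitive (@finer n).
Proof.
move=> Q P S /forall_inP PQ /forall_inP QS; apply/forall_inP => B /PQ.
move=> /exists_inP[C /QS /exists_inP[D DS CD] BC]; apply/exists_inP.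
by exists D => //; apply: subset_trans CD.
Qed.

Lemma finer_anti n : antisymmetric (@finer n).
Proof.
have sub (P Q : setpart n) : finer P Q -> finer Q P ->
    blocks P \subset blocks Q.
  move=> /forall_inP PQ /forall_inP QP; apply/subsetP => B BP.
  have /exists_inP[C CQ BC] := PQ B BP.
  have /exists_inP[D DP CD] := QP C CQ.
  have /and3P[_ /trivIsetP tI P0] := blocksP P.
  have BD : B = D.
    apply/eqP/negPn/negP => /(tI _ _ BP DP) /pred0P dBD.
    case: (set_0Vmem B) => [B0|[x xB]]; first by rewrite -B0 BP in P0.
    have /= := dBD x.
    by rewrite xB (subsetP CD) ?(subsetP BC).
  suff -> : B = C by [].
  by apply/eqP; rewrite eqEsubset BC BD CD.
move=> P Q /andP[PQ QP]; apply/val_inj/eqP.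
by rewrite eqEsubset !sub.
Qed.

Fact setpart_display : Order.disp_t. Proof. exact: Order.Disp tt tt. Qed.

HB.instance Definition _ n :=
  Order.Le_isPOrder.Build setpart_display (setpart n)
    (@finer_refl n) (@finer_anti n) (@finer_trans n).

Definition same_block n (P : setpart n) (i j : 'I_n) : bool :=
  j \in pblock (blocks P) i.

Definition noncrossing n (P : setpart n) : Prop :=
  ~ exists i j k l : 'I_n,
      [/\ (i < j < k)%N, (k < l)%N, same_block P i k, same_block P j l
        & ~~ same_block P i j].

(* Any injective numbering of the blocks would do. *)
Definition block_num n (P : setpart n) (i : 'I_n) : nat :=
  index (pblock (blocks P) i) (enum (blocks P)).

From mathcomp Require Import complex.
From mathcomp Require Import boolp classical_sets functions reals.

Local Open Scope classical_set_scope.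
Local Open Scope complex_scope.

(* Completeness is not required, so that C*-algebras are included. *)
HB.mixin Record isPreCstar (R : realType) A of GRing.Algebra R[i] A := {
  star : A -> A;
  cnorm : A -> R;
  starK : involutive star;
  star_linear : forall (c : R[i]) (x y : A),
    star (c *: x + y) = Num.conj c *: star x + star y;
  starM : forall x y : A, star (x * y) = star y * star x;
  cnorm_eq0 : forall x : A, cnorm x = 0 -> x = 0;
  cnormD : forall x y : A, cnorm (x + y) <= cnorm x + cnorm y;
  cnormZ : forall (c : R[i]) (x : A), (cnorm (c *: x))%:C = `|c| * (cnorm x)%:C;
  cnormM : forall x y : A, cnorm (x * y) <= cnorm x * cnorm y;
  cnorm_star : forall x : A, cnorm (star x * x) = cnorm x ^+ 2
}.

#[short(type="preCstarType")]
HB.structure Definition PreCstar (R : realType) :=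
  {A of GRing.Algebra R[i] A & isPreCstar R A}.

Definition is_subalg (K : nzRingType) (V : algType K) (S : set V) : Prop :=
  [/\ S 1,
      forall (c : K) (x y : V), S x -> S y -> S (c *: x + y)
    & forall x y : V, S x -> S y -> S (x * y)].

Definition gen_subalg (K : nzRingType) (V : algType K) (G : set V) : set V :=
  smallest (@is_subalg K V) G.

Section States.
Context (R : realType) (A : preCstarType R).

Definition norm_closure (S : set A) : set A :=
  [set x | forall e : R, 0 < e -> exists2 y, S y & cnorm (x - y) < e].

Definition is_star_subalg (S : set A) : Prop :=
  is_subalg S /\ forall x, S x -> S (star x).

(* A state on the subalgebra [S]: a positive linear functional of norm one.
   The bound is automatic on a C*-algebra. *)
Definition is_state_on (S : set A) (f : A -> R[i]) : Prop :=
  [/\ forall (c : R[i]) (x y : A), S x -> S y -> f (c *: x + y) = c * f x + f y,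
      f 1 = 1,
      forall x, S x -> 0 <= f (star x * x)
    & forall x, S x -> `|f x| <= (cnorm x)%:C].

(* Positivity in the completion of [A]: the positive elements of a C*-algebra
   are the [star b * b], and [A] is dense in its completion. *)
Definition pos_elt (x : A) : Prop :=
  norm_closure [set star b * b | b in [set: A]] x.

Definition faithful (f : A -> R[i]) : Prop :=
  forall x, f (star x * x) = 0 -> x = 0.

Definition cond_exp (B : set A) (psi : A -> A) : Prop :=
  [/\ is_star_subalg B,
      forall (c : R[i]) (x y : A), psi (c *: x + y) = c *: psi x + psi y,
      psi 1 = 1,
      forall x, pos_elt x -> pos_elt (psi x)
    & range psi = B /\
      forall b x b', B b -> B b' -> psi (b * x * b') = b * psi x * b'].

End States.

Record ncprob (R : realType) := NCProb {
  ncalg :> preCstarType R;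
  st : ncalg -> R[i];
  stP : is_state_on [set: ncalg] st
}.
Arguments st {R} n _.

(* The set of indices is [nat], so that the copies written 1, 2 in the
   literature are the copies 0, 1 here. The values of [act] at maps which are
   not permutations are irrelevant. The copies generate the universe
   topologically, which covers both purely algebraic generation and generation
   as a C*-algebra. *)
Record exch_system (R : realType) (A : ncprob R) := ExchSystem {
  univ :> ncprob R;
  cpy : nat -> {lrmorphism A -> univ};
  cpy_star : forall k x, cpy k (star x) = star (cpy k x);
  cpy_st : forall k x, st univ (cpy k x) = st A x;
  exchangeable : forall n (X : 'I_n -> A) (h : 'I_n -> nat) (s : nat -> nat),
    bijective s ->
    st univ (\prod_(i < n) cpy (h i) (X i)) =
    st univ (\prod_(i < n) cpy (s (h i)) (X i));
  generated :
    norm_closure (gen_subalg (\bigcup_k range (cpy k))) = [set: univ];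
  act : (nat -> nat) -> {lrmorphism univ -> univ};
  act_star : forall s x, bijective s -> act s (star x) = star (act s x);
  act_id : forall x, act id x = x;
  act_comp : forall s t x, bijective s -> bijective t ->
    act (s \o t) x = act s (act t x);
  act_cpy : forall s k x, bijective s -> act s (cpy k x) = cpy (s k) x;
  act_st : forall s x, bijective s -> st univ (act s x) = st univ x
}.
Arguments cpy {R A} e k.

Section Exchangeability.
Context (R : realType) (A : ncprob R) (E : exch_system A).

Definition moment n (P : setpart n) (X : 'I_n -> A) : R[i] :=
  st E (\prod_(i < n) cpy E (block_num P i) (X i)).

Definition cumulant n (P : setpart n) (X : 'I_n -> A) : R[i] :=
  \sum_(Q : setpart n | (Q <= P)%O) moment Q X * (moebius Q P)%:~R.

Definition weak_singleton : Prop :=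
  forall n (X : 'I_n -> A) (h : 'I_n -> nat) (j : 'I_n),
    (forall k, h k = h j -> k = j) ->
    st E (star (cpy E 0 (X j)) * cpy E 1 (X j)) = 0 ->
    st E (\prod_(i < n) cpy E (h i) (X i)) = 0.

Definition alg_of (I : set nat) : set E :=
  gen_subalg (\bigcup_(k in I) range (cpy E k)).

(* The graph of the homomorphism [alg_of I -> alg_of (f @` I)] which maps
   [cpy k a] to [cpy (f k) a]. This is not expressed through [act] because an
   injection of an infinite [I] need not extend to a permutation. *)
Definition copy_graph (I : set nat) (f : nat -> nat) : set (E * E)%type :=
  gen_subalg [set (cpy E p.1 p.2, cpy E (f p.1) p.2)
             | p in [set p : nat * A | I p.1]].

Definition centered (I : set nat) (X : E) : Prop :=
  exists (f g : nat -> nat) (X1 X2 : E),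
    [/\ set_inj I f, set_inj I g, (f @` I) `&` (g @` I) = set0,
        copy_graph I f (X, X1) /\ copy_graph I g (X, X2)
      & st E (star X1 * X2) = 0].

(* The product must not be empty: the empty product has state 1. *)
Definition weak_freeness : Prop :=
  forall (I : nat -> set nat), trivIset [set: nat] I ->
  forall n (X : 'I_n.+1 -> E) (idx : 'I_n.+1 -> nat),
    (forall j, alg_of (I (idx j)) (X j)) ->
    (forall j k : 'I_n.+1, k = j.+1 :> nat -> idx j <> idx k) ->
    (forall j, centered (I (idx j)) (X j)) ->
    st E (\prod_(j < n.+1) X j) = 0.

Section Embedding.
Context (V : preCstarType R) (j : E -> V) (psi : V -> V).

Definition interchangeable : Prop :=
  forall n (X : 'I_n -> A) (h : 'I_n -> nat) (s : nat -> nat), bijective s ->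
    psi (\prod_(i < n) j (cpy E (h i) (X i))) =
    psi (\prod_(i < n) j (cpy E (s (h i)) (X i))).

Definition free_amalgamated : Prop :=
  forall n (X : 'I_n.+1 -> A) (h : 'I_n.+1 -> nat),
    (forall i, psi (j (cpy E 0 (X i))) = 0) ->
    (forall i k : 'I_n.+1, k = i.+1 :> nat -> h i <> h k) ->
    psi (\prod_(i < n.+1) j (cpy E (h i) (X i))) = 0.

End Embedding.

Definition embeds_in_amalgamated_free_product : Prop :=
  exists (V : preCstarType R) (B : set V) (psi : V -> V)
         (j : {lrmorphism E -> V}) (tau : V -> R[i]),
    [/\ cond_exp B psi,
        injective j /\ (forall x, j (star x) = star (j x)),
        is_state_on B tau /\ (forall x, tau (psi (j x)) = st E x),
        interchangeable j psi
      & free_amalgamated j psi].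

End Exchangeability.

(* Main.v *)
From HB Require Import structures.
Require Import Defs.
From mathcomp Require Import all_boot all_order all_algebra.
From mathcomp Require Import complex reals.
From mathcomp Require boolp.
From mathcomp Require Import zify ring lra.

Set Implicit Arguments.
Unset Strict Implicit.
Unset Printing Implicit Defensive.

Import Order.TTheory GRing.Theory Num.Theory.

(** The two assertions rest on different ideas.

    Crossing cumulants. For any element W of an algebra generated by copies
    indexed in I, the difference of W and a copy of W on fresh indices in I is
    centered in the sense of weak freeness: the four terms of its second moment
    agree by exchangeability ([centered_difference]). Take a partition P, color
    its blocks, and cut the positions into the maximal monochromatic intervals,
    here called runs. Weak freeness kills the product, over the runs, of the
    word of the run minus its fresh copy. Expanding this product, and writing
    moments as sums of cumulants, turns the vanishing into an identity
    ([unsaturated_cumulant_sum]): the cumulants K_Q, over the Q below P for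
    which no run is a union of blocks of Q, sum to 0. A noncrossing Q always has
    a run which is a union of its blocks ([saturated_exists]), so that only
    crossing Q occur. If P crosses, the coloring can be chosen such that P
    itself occurs ([exists_unsaturated_coloring]): fix a crossing, and as long
    as a run is a union of blocks of P give it the color of a neighboring run.
    By induction along the order of partitions every K_Q with Q < P is 0, and
    so K_P = 0 ([crossing_cumulant_eq0]).

    Embedding. Call a letter X of A tail-null when st(X^(0)^* X^(1)) = 0. By the
    first part and the singleton condition, the state vanishes on every
    alternating word of tail-null letters, even when the word stands between
    two letters of one further copy: a noncrossing partition compatible with
    such a word isolates an inner letter ([conjugated_alternating_eq0]). Let K
    be the set of all states on the universe which are invariant under
    permutations of the copies on words and vanish on the alternating words of
    tail-null letters. The algebra of bounded functions from K to the universe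
    contains the universe as the constants, and evaluating the value at w in K
    by the state w itself is a conditional expectation psi onto the scalar
    valued functions ([expectation_cond_exp]). Interchangeability holds by the
    choice of K. For freeness it remains to see that a letter X killed by psi is
    tail-null ([tail_null_of_states]), that is, that K is large. It contains the
    states x |-> lim_N st(v^(N)^* x v^(N)) / st(v^* v), which exist because the
    sequence is eventually constant on a dense subalgebra ([tilted_state]);
    polarizing in v = c + X recovers st(X^(1)^* X^(0)) from their values
    at X. *)

(** * Moebius inversion, set partitions and runs of a coloring *)

Section MoebiusInversion.
Local Open Scope ring_scope.
Context d (T : finPOrderType d) (V : pzRingType).

Lemma moebius_sum (x z : T) : (x <= z)%O ->
  \sum_(y | (x <= y)%O && (y <= z)%O) moebius x y = (x == z)%:R.
Proof.
move=> xz; rewrite (bigD1 z) /= ?xz ?lexx // moebiusE xz.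
have [<-|nxz] := eqVneq x z.
  by rewrite big1 ?addr0 // => y /andP[/le_anti->]; rewrite eqxx.
apply/eqP; rewrite addrC subr_eq0; apply/eqP/eq_bigl => y.
by rewrite -andbA [(y < z)%O]lt_neqAle [(y != z) && _]andbC.
Qed.

Lemma moebius_inversion (f : T -> V) (z : T) :
  \sum_(y | (y <= z)%O) \sum_(x | (x <= y)%O) f x * (moebius x y)%:~R = f z.
Proof.
rewrite (exchange_big_dep (fun x => x <= z)%O) /=; last first.
  by move=> y x yz xy; exact: le_trans xy yz.
transitivity (\sum_(x | (x <= z)%O) f x * (x == z)%:R).
  apply: eq_bigr => x xz; rewrite -big_distrr -rmorph_sum /=; congr (_ * _).
  by rewrite (eq_bigl _ _ (fun y => andbC _ _)) moebius_sum // rmorph_nat.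
rewrite (bigD1 z) ?lexx //= eqxx mulr1 big1 ?addr0 // => x /andP[_ /negPf->].
by rewrite mulr0.
Qed.

End MoebiusInversion.

Section Partitions.
Context (n : nat).
Implicit Types (P Q : setpart n) (i j k : 'I_n).

Lemma same_blockE P i j :
  same_block P i j = (pblock (blocks P) i == pblock (blocks P) j).
Proof.
have /and3P[/eqP cP tI _] := blocksP P.
by rewrite /same_block eq_pblock // cP inE.
Qed.

Lemma same_block_sym P i j : same_block P i j = same_block P j i.
Proof. by rewrite !same_blockE eq_sym. Qed.

Lemma finerP P Q :
  reflect (forall i j, same_block P i j -> same_block Q i j) (P <= Q)%O.
Proof.
have [/eqP cP tP P0] := and3P (blocksP P).
have [/eqP cQ tQ Q0] := and3P (blocksP Q).
apply: (iffP idP) => [/forall_inP PQ i j sij|PQ].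
  have iP : i \in cover (blocks P) by rewrite cP inE.
  have /exists_inP[C CQ BC] := PQ _ (pblock_mem iP).
  have iC : i \in C by rewrite (subsetP BC) // mem_pblock.
  by rewrite /same_block (def_pblock tQ CQ iC) (subsetP BC).
apply/forall_inP => B BP.
have [B0|[i iB]] := set_0Vmem B; first by rewrite -B0 BP in P0.
have iQ : i \in cover (blocks Q) by rewrite cQ inE.
apply/exists_inP; exists (pblock (blocks Q) i); first exact: pblock_mem.
apply/subsetP => j jB; apply: PQ.
by rewrite /same_block (def_pblock tP BP iB).
Qed.

(** The moment of a word with index function [h] depends on [h] only through
    this partition ([st_moment]). *)
Definition kernel (T : eqType) (h : 'I_n -> T) : setpart n :=
  SetPart (preim_partitionP h [set: 'I_n]).

Lemma same_block_kernel (T : eqType) (h : 'I_n -> T) i j :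
  same_block (kernel h) i j = (h i == h j).
Proof.
rewrite /same_block /= pblock_equivalence_partition ?inE //.
by split=> // /eqP->.
Qed.

Lemma block_num_eq P i j :
  (block_num P i == block_num P j) = same_block P i j.
Proof.
have [/eqP cP tP P0] := and3P (blocksP P).
have inP k : pblock (blocks P) k \in enum (blocks P).
  by rewrite mem_enum pblock_mem // cP inE.
rewrite same_blockE /block_num; apply/eqP/eqP => [|->//].
by move/(congr1 (nth set0 (enum (blocks P)))); rewrite !nth_index.
Qed.

Lemma crossingP P : ~ noncrossing P ->
  exists i j k l : 'I_n, [/\ (i < j < k)%N, (k < l)%N, same_block P i k,
    same_block P j l & ~~ same_block P i j].
Proof. exact: boolp.contrapT. Qed.

End Partitions.

Section Runs.
Context (C : eqType).
Implicit Types (c : nat -> C) (i j k s t : nat).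

(** The number of color changes before position [i]: the maximal monochromatic
    intervals are the fibers of [run c]. *)
Definition run c i : nat := (\sum_(0 <= k < i) (c k != c k.+1))%N.

Lemma runS c i : run c i.+1 = (run c i + (c i != c i.+1))%N.
Proof. by rewrite /run big_nat_recr. Qed.

Lemma run0 c : run c 0 = 0%N.
Proof. by rewrite /run big_geq. Qed.

Lemma leq_run c : {homo run c : i j / (i <= j)%N}.
Proof.
by apply: homo_leq => //; [exact: leq_trans|move=> i; rewrite runS leq_addr].
Qed.

Lemma run_lt_pos c i j : (run c i < run c j)%N -> (i < j)%N.
Proof. by apply: contraTT; rewrite -!leqNgt; exact: leq_run. Qed.

Lemma run_color_le c i j : (i <= j)%N -> run c i = run c j -> c i = c j.
Proof.
elim: j => [|j IH]; first by rewrite leqn0 => /eqP->.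
rewrite leq_eqVlt => /predU1P[->//|ij] rij.
have rj : run c i = run c j.
  by apply/eqP; rewrite eqn_leq leq_run // rij leq_run.
rewrite (IH ij rj); apply/eqP; move/eqP: rij.
by rewrite runS -rj -{1}[run c i]addn0 eqn_add2l; case: (_ == c j.+1).
Qed.

Lemma run_color c i j : run c i = run c j -> c i = c j.
Proof.
case: (leqP i j) => [|/ltnW] ij rij; first exact: run_color_le.
by apply/esym/run_color_le.
Qed.

(** [run c] grows by steps of at most one, so that it takes every intermediate
    value, and takes it last just before a change of color. *)
Lemma run_jump c i k t : (run c i <= t)%N -> (t < run c k)%N ->
  exists b, [/\ (i <= b < k)%N, run c b = t & run c b.+1 = t.+1].
Proof.
elim: k => [|k IH] it tk.
  by rewrite run0 in tk.
have [tk'|kt] := ltnP t (run c k).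
  have [b [/andP[ib bk] rb rbS]] := IH it tk'.
  by exists b; rewrite ib ltnS ltnW.
have rk : run c k = t.
  apply/eqP; rewrite eqn_leq kt /=; move: tk; rewrite runS.
  by case: (c k != _); rewrite ?addn1 ?ltnS // addn0 => /ltnW.
have ik : (i <= k)%N.
  have /run_lt_pos : (run c i < run c k.+1)%N by exact: leq_ltn_trans it tk.
  by [].
exists k; rewrite ik ltnSn rk; split=> //; apply/eqP.
by rewrite eqn_leq tk andbT runS rk; case: (c k != _); rewrite ?addn1 ?addn0.
Qed.

Lemma run_adjacent c i k : run c k = (run c i).+1 -> c i != c k.
Proof.
move=> rk; have [|b [_ rb rbS]] := @run_jump c i k _ (leqnn _).
  by rewrite rk.
rewrite (run_color (esym rb)) (run_color (etrans rk (esym rbS))).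
by move: rbS; rewrite runS rb; case: (c b != _) => //; rewrite addn0 => /n_Sn.
Qed.

Lemma run_attained c n : (0 < n)%N -> forall s : 'I_(run c n.-1).+1,
  exists i : 'I_n, run c i = s.
Proof.
move=> n0 s; have n1 : (n.-1 < n)%N by rewrite prednK.
have := ltn_ord s; rewrite ltnS leq_eqVlt => /predU1P[sm|sm].
  by exists (Ordinal n1); rewrite /= sm.
have [|b [/andP[_ bn] rb _]] := @run_jump c 0 n.-1 s _ sm.
  by rewrite run0.
by exists (Ordinal (ltn_trans bn n1)); rewrite /= rb.
Qed.

End Runs.

Section NoncrossingRuns.
Context (n : nat) (C : eqType) (c : nat -> C).
Implicit Types (P Q : setpart n).

Definition saturated Q (s : nat) : bool :=
  [forall i : 'I_n, forall j : 'I_n,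
     same_block Q i j ==> ((run c i == s) == (run c j == s))].

Definition colors_blocks Q : Prop :=
  forall i j : 'I_n, same_block Q i j -> c i = c j.

Lemma unsaturatedP Q s : ~~ saturated Q s ->
  exists i j : 'I_n, [/\ same_block Q i j, run c i = s & run c j != s].
Proof.
case/forallPn => i /forallPn[j]; rewrite negb_imply => /andP[sij].
have [rj|nrj] := eqVneq (run c j) s; have [ri|nri] := eqVneq (run c i) s => //.
  by exists j, i; rewrite same_block_sym.
by exists i, j.
Qed.

(** Take a link between two runs. If the run just after the left one is not
    saturated it has a link of its own, which can neither cross the given one
    nor reach the runs next to it, whose colors differ from its own. So this link
    is nested inside the given one, and the distance of the linked runs decreases. *)
Lemma saturated_between Q (i k : 'I_n) : noncrossing Q -> colors_blocks Q ->
  same_block Q i k -> (run c i < run c k)%N ->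
  exists j : 'I_n, (run c i < run c j < run c k)%N /\ saturated Q (run c j).
Proof.
move=> nc cQ.
have [m] := ubnP (run c k - run c i); elim: m => // m IH in i k *.
rewrite ltnS => lem sik lik.
have adj (a b : 'I_n) : run c b = (run c a).+1 -> same_block Q a b -> False.
  by move=> /run_adjacent /eqP ab /cQ.
have nadj : run c k != (run c i).+1 by apply/eqP => /adj; exact.
have [b [/andP[ib bk] _ rj]] := run_jump (leqnn _) lik.
have bn : (b.+1 < n)%N by apply: leq_ltn_trans (ltn_ord k).
pose j := Ordinal bn; have {}rj : run c j = (run c i).+1 by [].
have lij : (run c i < run c j)%N by rewrite rj.
have ljk : (run c j < run c k)%N.
  by rewrite rj ltn_neqAle eq_sym nadj.
have [sat|/unsaturatedP[j' [l [sjl rj' rl]]]] := boolP (saturated Q (run c j)).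
  by exists j; rewrite lij ljk.
rewrite -rj' in rj lij ljk rl; move: {j bn} j' {rj'} rj lij ljk sjl rl.
move=> j rj lij ljk sjl rl.
have [llj|] := ltnP (run c l) (run c j); last first.
  rewrite leq_eqVlt eq_sym (negPf rl) /= => ljl.
  have [llk|lkl] := leqP (run c l) (run c k).
    have [||//|p [/andP[lp pl] sat]] := IH j l.
    - by apply: leq_trans lem; lia.
    - exact: sjl.
    exists p; split=> //.
    by rewrite (ltn_trans lij lp) (leq_trans pl llk).
  case: nc; exists i, j, k, l; split=> //.
  - by rewrite (run_lt_pos lij) (run_lt_pos ljk).
  - exact: run_lt_pos lkl.
  - by apply/negP; exact: adj.
have lli : (run c l <= run c i)%N by rewrite -ltnS -rj.
have cli : c l != c i.
  by rewrite (cQ l j) 1?same_block_sym // eq_sym run_adjacent.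
have {}lli : (run c l < run c i)%N.
  by rewrite ltn_neqAle lli andbT; apply: contra_neq cli => /run_color.
case: nc; exists l, i, j, k; split=> //.
- by rewrite (run_lt_pos lli) (run_lt_pos lij).
- exact: run_lt_pos ljk.
- by rewrite same_block_sym.
- by apply: contraNN cli => /cQ->.
Qed.

(** Analogue for runs of the fact that a noncrossing partition has a block which
    is an interval. *)
Lemma saturated_exists Q : (0 < n)%N -> noncrossing Q -> colors_blocks Q ->
  exists i : 'I_n, saturated Q (run c i).
Proof.
move=> n0 nc cQ; pose i := Ordinal n0.
have [sat|/unsaturatedP[j [l [sjl rj rl]]]] := boolP (saturated Q (run c i)).
  by exists i.
rewrite -rj in rl; case: (ltngtP (run c l) (run c j)) rl => // lt _.
  rewrite same_block_sym in sjl.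
  by have [k [_ sat]] := saturated_between nc cQ sjl lt; exists k.
by have [k [_ sat]] := saturated_between nc cQ sjl lt; exists k.
Qed.

End NoncrossingRuns.

(** The case of [saturated_between] in which every run is a single letter: the
    blocks of [Q] serve as colors. *)
Lemma singleton_between n (Q : setpart n) (i k : 'I_n) : noncrossing Q ->
  (forall a b : 'I_n, b = a.+1 :> nat -> ~~ same_block Q a b) ->
  same_block Q i k -> (i < k)%N ->
  exists j : 'I_n, (i < j < k)%N /\ forall l, same_block Q j l -> l = j.
Proof.
move=> nc adj sik ik.
have n0 : (0 < n)%N by exact: leq_ltn_trans (ltn_ord k).
pose c (p : nat) := pblock (blocks Q) (insubd (Ordinal n0) p).
have cE (a : 'I_n) : c a = pblock (blocks Q) a by rewrite /c valKd.
have runE (p : nat) : (p < n)%N -> run c p = p.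
  elim: p => [|p IH] pn; first by rewrite run0.
  rewrite runS IH ?(ltnW pn) // (cE (Ordinal (ltnW pn))) (cE (Ordinal pn)).
  have := adj (Ordinal (ltnW pn)) (Ordinal pn) erefl.
  by rewrite same_blockE => ->; rewrite addn1.
have runO (a : 'I_n) : run c a = a by rewrite runE.
have [||j [jb sat]] := @saturated_between n _ c Q i k nc _ sik.
- by move=> a b; rewrite same_blockE !cE => /eqP->.
- by rewrite !runO.
rewrite !runO in jb sat; exists j; split=> // l sjl.
move/forallP/(_ j)/forallP/(_ l): sat; rewrite sjl !runO eqxx /=.
by move/eqP/esym/eqP/val_inj.
Qed.

(** Start from the coloring by blocks, and keep a crossing whose two blocks have
    different colors. A saturated run avoids the four points of this crossing,
    since with one of them it would contain two of different color. Recoloring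
    it like a neighboring run therefore keeps the invariants, and lowers the
    number of runs. *)
Lemma exists_unsaturated_coloring n (P : setpart n) : ~ noncrossing P ->
  exists c : nat -> nat, colors_blocks c P /\
    forall i : 'I_n, ~~ saturated c P (run c i).
Proof.
move=> /crossingP[i [j [k [l [/andP[ij jk] kl sik sjl nij]]]]].
have n0 : (0 < n)%N by exact: leq_ltn_trans (ltn_ord k).
suff main m (c : nat -> nat) : (run c n.-1 <= m)%N -> colors_blocks c P ->
    c i != c j -> exists c' : nat -> nat, colors_blocks c' P /\
    forall i : 'I_n, ~~ saturated c' P (run c' i).
  pose c p := block_num P (insubd (Ordinal n0) p).
  have cE (a : 'I_n) : c a = block_num P a by rewrite /c valKd.
  apply: (main _ c (leqnn _)); last by rewrite !cE block_num_eq.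
  by move=> a b sab; apply/eqP; rewrite !cE block_num_eq.
elim: m c => [|m IH] c cm cP cij.
  suff /eqP : c i = c j by rewrite (negPf cij).
  apply: run_color; move: cm; rewrite leqn0 => /eqP cm.
  have r0 (a : 'I_n) : run c a = 0%N.
    by apply/eqP; rewrite -leqn0 -cm leq_run // -ltnS prednK.
  by rewrite !r0.
have [|/forallPn[a]] := boolP [forall a : 'I_n, ~~ saturated c P (run c a)].
  by move=> /forallP; exists c.
rewrite negbK; set s := run c a => sat.
have satP (p q : 'I_n) : same_block P p q -> (run c p == s) = (run c q == s).
  move=> spq; move/forallP/(_ p)/forallP/(_ q): sat.
  by rewrite spq => /eqP.
have rij := leq_run c (ltnW ij); have rjk := leq_run c (ltnW jk).
have rkl := leq_run c (ltnW kl).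
have nij_s : (run c i != s) && (run c j != s).
  have sik' := satP _ _ sik; have sjl' := satP _ _ sjl.
  by apply/andP; split; apply: contraNN cij => /eqP rs; apply/eqP/run_color; lia.
have [ri rj] := andP nij_s.
(* [b] is an end of the run [s] shared with a neighbor, on the left unless [s]
   is the first run, and [e] is the color of this neighbor. *)
have [b [bn rb [e eb]]] : exists b, [/\ (b.+1 < n)%N, c b != c b.+1 &
   exists e, (run c b == s = false /\ run c b.+1 == s /\ e = c b) \/
     (run c b == s /\ run c b.+1 == s = false /\ e = c b.+1)].
  have [s0|s0] := posnP s.
    have i0 : (0 < run c i)%N by rewrite lt0n -s0.
    have [|b [/andP[_ bi] rb rbS]] := @run_jump _ c 0 i 0 _ i0.
      by rewrite run0.
    exists b; split; first exact: leq_ltn_trans (ltn_ord i).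
      by apply: run_adjacent; rewrite rbS rb.
    by exists (c b.+1); right; rewrite rb rbS s0.
  have [|| b [/andP[_ bi] rb rbS]] := @run_jump _ c 0 a s.-1.
  - by rewrite run0.
  - by rewrite prednK.
  rewrite prednK // in rbS.
  exists b; split; first exact: leq_ltn_trans (ltn_ord a).
    by apply: run_adjacent; rewrite rbS rb prednK.
  exists (c b); left; rewrite rb rbS eqxx; split=> //.
  by rewrite -{2}(prednK s0) ltn_eqF.
pose c' p := if run c p == s then e else c p.
apply: (IH c') => [||]; last by rewrite /c' (negPf ri) (negPf rj).
- (* The change of color at [b] disappears, and no new one is created. *)
  rewrite -ltnS; apply: leq_trans cm.
  rewrite /run !(big_mkord xpredT) -(prednK n0) /=.
  have b1 : (b < n.-1)%N by rewrite -ltnS prednK.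
  rewrite (bigD1 (Ordinal b1)) //= [ltnRHS](bigD1 (Ordinal b1)) //= rb.
  have -> : c' b = c' b.+1.
    by rewrite /c'; case: eb => -[-> [-> ->]].
  rewrite eqxx add0n add1n ltnS; apply: leq_sum => p _.
  have [cp|_] := eqVneq (c p) (c p.+1); last exact: leq_b1.
  have rp : run c p.+1 = run c p by rewrite runS cp eqxx addn0.
  by rewrite /c' rp cp eqxx.
- move=> p q spq; rewrite /c' (satP _ _ spq).
  by case: ifP => // _; exact: cP.
Qed.

(** The partition on the left is [P] with every run selected by [f] cut off from
    the rest, as happens to the indices when the words of these runs are replaced
    by fresh copies. *)
Lemma le_kernel_split n m (P Q : setpart n) (c : nat -> nat)
    (f : {ffun 'I_m.+1 -> bool}) : (forall i : 'I_n, run c i < m.+1)%N ->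
  (Q <= kernel (fun i => (block_num P i,
      if f (inord (run c i)) then (run c i).+1 else 0%N)))%O =
  (Q <= P)%O && [forall s : 'I_m.+1, f s ==> saturated c Q s].
Proof.
move=> rm.
have eq_inord s (i : 'I_n) : (inord (run c i) == s :> 'I_m.+1) = (run c i == s).
  by rewrite -val_eqE /= inordK.
apply/finerP/andP => [Qk|[QP /forallP fsat] i j sij].
  have {}Qk i j : same_block Q i j -> same_block P i j /\
      (if f (inord (run c i)) then (run c i).+1 else 0%N) =
      (if f (inord (run c j)) then (run c j).+1 else 0%N).
    by move=> /Qk; rewrite same_block_kernel xpair_eqE block_num_eq => /andP[-> /eqP].
  split; first by apply/finerP => i j /Qk[].
  apply/forallP => s; apply/implyP => fs; apply/forallP => i; apply/forallP => j.
  have imp (a b : 'I_n) : same_block Q a b -> run c a = s -> run c b = s.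
    move=> /Qk[_ +] ra; rewrite ra inord_val fs.
    by case: (f _) => // -[<-].
  apply/implyP => sij; apply/eqP; apply/idP/idP => /eqP rs; apply/eqP.
    exact: imp sij rs.
  by apply: imp rs; rewrite same_block_sym.
rewrite same_block_kernel xpair_eqE block_num_eq (finerP _ _ QP) //=.
have satE s : f s -> (run c i == s) = (run c j == s).
  move=> fs; have := fsat s; rewrite fs => /forallP/(_ i)/forallP/(_ j).
  by rewrite sij => /eqP.
have [fi|nfi] := boolP (f (inord (run c i))).
  have := satE _ fi; rewrite -!eq_inord eqxx => /esym/eqP rij.
  have := congr1 val rij; rewrite /= !inordK // => ->.
  by rewrite fi.
have [fj|//] := boolP (f (inord (run c j))).
have := satE _ fj; rewrite -!eq_inord eqxx => /eqP rij.
by rewrite rij fj in nfi.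
Qed.

(** * Permutations of the indices and ordered products *)

Definition swap (a b k : nat) : nat :=
  if k == a then b else if k == b then a else k.

Lemma swapL a b : swap a b a = b.
Proof. by rewrite /swap eqxx. Qed.

Lemma swapR a b : swap a b b = a.
Proof. by rewrite /swap eqxx; case: eqP. Qed.

Lemma swap_id a b k : k != a -> k != b -> swap a b k = k.
Proof. by rewrite /swap => /negPf-> /negPf->. Qed.

Lemma swap_bij a b : bijective (swap a b).
Proof.
suff swapK : involutive (swap a b) by exists (swap a b).
move=> k; have [->|ka] := eqVneq k a; first by rewrite swapL swapR.
by have [->|kb] := eqVneq k b; rewrite ?swapR ?swapL // !swap_id.
Qed.

(** Exchangeability is about permutations of all the indices, whereas moments are
    compared along injections between finite sets of indices. *)
Lemma bijective_extension (T : finType) (u v : T -> nat) :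
  (forall x y, (u x == u y) = (v x == v y)) ->
  exists2 s : nat -> nat, bijective s & forall x, s (u x) = v x.
Proof.
move=> uv.
suff [s sb sE] : exists2 s : nat -> nat, bijective s &
    {in enum T, forall x, s (u x) = v x}.
  by exists s => // x; apply: sE; rewrite mem_enum.
elim: (enum T) => [|a r [s sb sE]]; first by exists id => //; exists id.
exists (swap (s (u a)) (v a) \o s); first exact: bij_comp (swap_bij _ _) sb.
move=> x; rewrite inE /= => /predU1P[->|xr]; first by rewrite swapL.
have [e|vne] := eqVneq (v x) (v a).
  have /eqP-> : u x == u a by rewrite uv e.
  by rewrite swapL.
by rewrite swap_id ?(inj_eq (bij_inj sb)) ?uv // sE.
Qed.

Lemma big_ord_fibers (T : Type) (idx : T) (op : Monoid.law idx) (n m : nat)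
    (r : nat -> nat) (F : 'I_n -> T) :
  {homo r : i j / (i <= j)%N} -> (forall i : 'I_n, r i < m)%N ->
  \big[op/idx]_(i < n) F i =
  \big[op/idx]_(s < m) \big[op/idx]_(i < n | r i == s) F i.
Proof.
move=> rmono rm.
suff main k : \big[op/idx]_(i < n | (r i < k)%N) F i =
    \big[op/idx]_(s < k) \big[op/idx]_(i < n | r i == s) F i.
  by rewrite -main; apply: eq_bigl => i; rewrite rm.
elim: k => [|k IH]; first by rewrite big_ord0 big_pred0.
rewrite big_ord_recr -IH /= {rm IH}; elim: n F => [|n IH] F.
  by rewrite !big_ord0 Monoid.mul1m.
have recr (p : pred nat) : \big[op/idx]_(i < n.+1 | p i) F i =
    op (\big[op/idx]_(i < n | p i) F (widen_ord (leqnSn n) i))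
       (if p n then F ord_max else idx).
  by rewrite big_mkcond big_ord_recr -big_mkcond.
rewrite (recr (fun i => r i < k.+1)%N) (recr (fun i => r i < k)%N).
rewrite (recr (fun i => r i == k)) /= {recr}.
rewrite IH; case: (ltngtP (r n) k) => rk.
- have e0 G : \big[op/idx]_(i < n | r i == k) G i = idx.
    rewrite big_pred0 // => i.
    by have := rmono i n (ltnW (ltn_ord i)); lia.
  by rewrite leqW // !e0 !Monoid.mulm1.
- by rewrite ltnNge rk !Monoid.mulm1.
- by rewrite rk ltnSn Monoid.mulm1 Monoid.mulmA.
Qed.

From mathcomp Require Import boolp classical_sets functions.

Local Open Scope ring_scope.
Local Open Scope complex_scope.
Local Open Scope classical_set_scope.

(** * Crossing cumulants vanish *)

Section Subalgebras.
Context (K : nzRingType) (V : algType K).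
Implicit Types (S G : set V).

Lemma gen_subalgP G : is_subalg (gen_subalg G).
Proof.
split=> [S [[]//]|c x y Sx Sy S SG|x y Sx Sy S SG]; have [[S1 Sl SM] GS] := SG.
- by apply: Sl; [exact: Sx|exact: Sy].
- by apply: SM; [exact: Sx|exact: Sy].
Qed.

Lemma mem_gen_subalg G x : G x -> gen_subalg G x.
Proof. by move=> Gx S [_]; exact. Qed.

Lemma is_subalgB S x y : is_subalg S -> S x -> S y -> S (x - y).
Proof. by move=> [_ Sl _] Sx Sy; rewrite addrC -scaleN1r; exact: Sl. Qed.

Lemma is_subalg_prod S I (r : seq I) (P : pred I) (F : I -> V) :
  is_subalg S -> (forall i, P i -> S (F i)) -> S (\prod_(i <- r | P i) F i).
Proof. by move=> [S1 _ SM] SF; apply: big_ind. Qed.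

End Subalgebras.

Section State.
Context (R : realType) (U : ncprob R).

Lemma st_linear : linear_for *%R (st U).
Proof. by have [stL _ _ _] := stP U => c x y; exact: stL. Qed.

HB.instance Definition _ :=
  GRing.isLinear.Build R[i] U R[i] *%R (st U) st_linear.

End State.

Section Exchangeability.
Context (R : realType) (A : ncprob R) (E : exch_system A).

Lemma st_same_kernel n (X : 'I_n -> A) (h h' : 'I_n -> nat) :
  (forall i j, (h i == h j) = (h' i == h' j)) ->
  st E (\prod_(i < n) cpy E (h i) (X i)) =
  st E (\prod_(i < n) cpy E (h' i) (X i)).
Proof.
move=> /bijective_extension[s sb sE]; rewrite (exchangeable E X h sb).
by congr (st E _); apply: eq_bigr => i _; rewrite sE.
Qed.

Lemma st_moment n (X : 'I_n -> A) (h : 'I_n -> nat) :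
  st E (\prod_(i < n) cpy E (h i) (X i)) = moment E (kernel h) X.
Proof.
by apply: st_same_kernel => i j; rewrite block_num_eq same_block_kernel.
Qed.

Lemma moment_cumulant n (P : setpart n) (X : 'I_n -> A) :
  moment E P X = \sum_(Q : setpart n | (Q <= P)%O) cumulant E Q X.
Proof. by rewrite -(moebius_inversion (fun Q => moment E Q X)). Qed.

(** The star of a word is a product in the reverse order, so permutations are
    applied here through their action on the universe. *)
Lemma st_star_same_kernel n (X : 'I_n -> A) (Q : pred 'I_n)
    (u v u' v' : 'I_n -> nat) :
  (forall i j, (u i == u j) = (u' i == u' j)) ->
  (forall i j, (v i == v j) = (v' i == v' j)) ->
  (forall i j, (u i == v j) = (u' i == v' j)) ->
  st E (star (\prod_(i < n | Q i) cpy E (u i) (X i)) *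
        \prod_(i < n | Q i) cpy E (v i) (X i)) =
  st E (star (\prod_(i < n | Q i) cpy E (u' i) (X i)) *
        \prod_(i < n | Q i) cpy E (v' i) (X i)).
Proof.
move=> uu vv uv.
pose w (u v : 'I_n -> nat) (x : 'I_n + 'I_n) :=
  match x with inl i => u i | inr i => v i end.
have [|s sb sE] := @bijective_extension _ (w u v) (w u' v').
  by case=> i; case=> j /=; rewrite // eq_sym uv eq_sym.
rewrite -(act_st _ sb) rmorphM /= act_star // !rmorph_prod.
congr (st E (star _ * _)); apply: eq_bigr => i _; rewrite /= act_cpy //.
  by rewrite (sE (inl i)).
by rewrite (sE (inr i)).
Qed.

(** With [W] and [W'] the two words, the second moment of two disjoint copies of
    [W - W'] is a signed sum of four terms which are equal by exchangeability. *)
Lemma centered_difference n (X : 'I_n -> A) (Q : pred 'I_n) (I : set nat)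
    (u v : 'I_n -> nat) :
  (forall i, Q i -> I (u i)) -> (forall i, Q i -> I (v i)) ->
  (forall i j, (u i == u j) = (v i == v j)) -> (forall i j, u i != v j) ->
  alg_of I (\prod_(i < n | Q i) cpy E (u i) (X i) -
            \prod_(i < n | Q i) cpy E (v i) (X i)) /\
  centered I (\prod_(i < n | Q i) cpy E (u i) (X i) -
            \prod_(i < n | Q i) cpy E (v i) (X i)).
Proof.
move=> uI vI uu uv.
have inA w : (forall i, Q i -> I (w i)) ->
    alg_of I (\prod_(i < n | Q i) cpy E (w i) (X i)).
  move=> wI; apply: is_subalg_prod; first exact: gen_subalgP.
  move=> i Qi; suff : (\bigcup_(k in I) range (cpy E k)) (cpy E (w i) (X i)).
    exact: mem_gen_subalg.
  by exists (w i); [exact: wI|exists (X i)].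
split; first exact: is_subalgB (gen_subalgP _) (inA u uI) (inA v vI).
pose p f (w : 'I_n -> nat) := \prod_(i < n | Q i) cpy E (f (w i)) (X i).
have inG f w : (forall i, Q i -> I (w i)) -> copy_graph I f (p id w, p f w).
  move=> wI; rewrite /p.
  have [S1 _ SM] := gen_subalgP
    [set (cpy E q.1 q.2, cpy E (f q.1) q.2) | q in [set q : nat * A | I q.1]].
  apply: (big_rec2 (fun a b => copy_graph I f (a, b))) => // i x y Qi xy.
  apply: (SM (_, _) (_, _)) xy.
  suff : [set (cpy E q.1 q.2, cpy E (f q.1) q.2) | q in [set q : nat * A | I q.1]]
      (cpy E (w i) (X i), cpy E (f (w i)) (X i)) by exact: mem_gen_subalg.
  by exists (w i, X i) => //; exact: wI.
have inGB f : copy_graph I f (p id u - p id v, p f u - p f v).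
  exact: is_subalgB (gen_subalgP _) (inG f u uI) (inG f v vI).
pose g m := m.*2.+1.
exists double, g, (p double u - p double v), (p g u - p g v); split.
- by move=> a b _ _; lia.
- by move=> a b _ _; rewrite /g; lia.
- by apply/seteqP; split=> // x [[a _ <-] [b _]]; rewrite /g; lia.
- by [].
have stp w w' : (w = u) \/ (w = v) -> (w' = u) \/ (w' = v) ->
    st E (star (p double w) * p g w') = st E (star (p double u) * p g u).
  move=> wuv wuv'; apply: st_star_same_kernel => i j; rewrite /g.
  - by case: wuv => ->; rewrite // !(inj_eq double_inj) uu.
  - by case: wuv' => ->; rewrite // !eqSS !(inj_eq double_inj) uu.
  - by lia.
rewrite -[p double u - _]addrC -scaleN1r star_linear rmorphN rmorph1 scaleN1r.
rewrite mulrBr !mulrDl !mulNr !(linearB, linearD, linearN) /=.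
rewrite !stp; try by [left|right].
by rewrite addNr add0r opprK subrr.
Qed.

Section CrossingCumulants.
Hypothesis hfree : weak_freeness E.
Context (n : nat) (X : 'I_n -> A).

(** Expand the vanishing product of differences over the sets of runs whose words
    are replaced by fresh copies. The cumulant of [Q] enters the moment of such a
    term exactly if all replaced runs are saturated for [Q], so its total
    coefficient is a product over the runs of [1 - 1] or [1 - 0]. *)
Lemma unsaturated_cumulant_sum (P : setpart n) (c : nat -> nat) :
  (0 < n)%N -> colors_blocks c P ->
  \sum_(Q : setpart n | (Q <= P)%O) cumulant E Q X *
    \prod_(s < (run c n.-1).+1) (1 - (saturated c Q s)%:R) = 0.
Proof.
move=> n0 cP; set m := run c n.-1; pose h := block_num P.
have rlt (i : 'I_n) : (run c i < m.+1)%N.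
  by rewrite ltnS leq_run // -ltnS prednK.
(* A fresh index is a pair of a block and the number of a run plus one; the
   original indices are paired with zero. *)
pose idx (b : bool) (s : nat) (i : 'I_n) := pickle (h i, if b then s.+1 else 0)%N.
have idx_eq b b' s s' i j : (idx b s i == idx b' s' j) =
    (h i == h j) && ((if b then s.+1 else 0) == (if b' then s'.+1 else 0))%N.
  by rewrite /idx (inj_eq (pcan_inj (@pickleK (nat * nat)%type))).
pose W (s : nat) b := \prod_(i < n | run c i == s) cpy E (idx b s i) (X i).
have [q qE] := choice (run_attained (c := c) n0).
pose I k := [set l : nat | exists i t, c (nat_of_ord i) = k /\ l = pickle (h i, t : nat)].
have tI : trivIset [set: nat] I.
  move=> k k' _ _ [l [[i [t [<- ->]]] [i' [t' [<-]]]]].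
  move/(pcan_inj (@pickleK (nat * nat)%type)) => [hh _].
  by apply: cP; rewrite -block_num_eq; apply/eqP.
have diff (s : 'I_m.+1) : alg_of (I (c (q s))) (W s false - W s true) /\
    centered (I (c (q s))) (W s false - W s true).
  apply: centered_difference => [i|i|i j|i j].
  - by move=> /eqP rs; exists i, 0%N; split=> //; apply: run_color; rewrite rs qE.
  - by move=> /eqP rs; exists i, s.+1; split=> //; apply: run_color; rewrite rs qE.
  - by rewrite !idx_eq !eqxx.
  - by rewrite idx_eq andbF.
have free0 : st E (\prod_(s < m.+1) (W s false - W s true)) = 0.
  apply: (hfree tI) (fun s => c (q s)) _ _ _.
  - by move=> s; have [] := diff s.
  - by move=> s t ts; apply/eqP; apply: run_adjacent; rewrite !qE.
  - by move=> s; have [] := diff s.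
rewrite -[RHS]free0.
pose F (s : 'I_m.+1) (b : bool) : E := (-1) ^+ b *: W s b.
rewrite [in RHS](eq_bigr (fun s => \sum_b F s b)); last first.
  by move=> s _; rewrite big_bool /F expr1 expr0 scaleN1r scale1r addrC.
rewrite bigA_distr_bigA linear_sum /=.
have split_moment (f : {ffun 'I_m.+1 -> bool}) :
    st E (\prod_s F s (f s)) = \prod_s (-1) ^+ f s *
      \sum_(Q : setpart n | (Q <= P)%O) cumulant E Q X *
         \prod_s (f s ==> saturated c Q s)%:R.
  rewrite /F scaler_prod linearZ /=; congr (_ * _).
  pose k (i : 'I_n) := idx (f (inord (run c i))) (run c i) i.
  transitivity (st E (\prod_(i < n) cpy E (k i) (X i))).
    congr (st E _); rewrite (big_ord_fibers _ _ (leq_run c) rlt).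
    apply: eq_bigr => s _; apply: eq_bigr => i /eqP rs.
    by rewrite /k rs inord_val.
  rewrite st_moment moment_cumulant big_mkcond [RHS]big_mkcond /=.
  apply: eq_bigr => Q _.
  have -> : kernel k = kernel (fun i => (block_num P i,
      if f (inord (run c i)) then (run c i).+1 else 0%N)).
    by apply/le_anti/andP; split; apply/finerP => i j;
      rewrite !same_block_kernel idx_eq xpair_eqE.
  rewrite le_kernel_split //.
  case: (Q <= P)%O => //=; case: ifPn => [/forallP fsat|/forallPn[s /negPf nfs]].
    by rewrite big1 ?mulr1 // => s _; rewrite fsat.
  by rewrite (bigD1 s) //= nfs mul0r mulr0.
under [RHS]eq_bigr do rewrite split_moment.
under [RHS]eq_bigr do rewrite big_distrr /=.
rewrite exchange_big /=; apply: eq_bigr => Q _.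
under [RHS]eq_bigr do rewrite mulrCA -big_split /=.
rewrite -big_distrr /=; congr (_ * _).
rewrite -(bigA_distr_bigA (fun (s : 'I_m.+1) (b : bool) =>
  (-1) ^+ nat_of_bool b * (b ==> saturated c Q s)%:R)).
apply: eq_bigr => s _; rewrite big_bool /= expr1 expr0 mulN1r mul1r addrC.
by [].
Qed.

Lemma crossing_cumulant_eq0 (P : setpart n) :
  ~ noncrossing P -> cumulant E P X = 0.
Proof.
have [N] := ubnP #|[pred Q : setpart n | (Q <= P)%O]|.
elim: N => // N IH in P *; rewrite ltnS => PN cr.
have [c [cP unsat]] := exists_unsaturated_coloring cr.
have n0 : (0 < n)%N.
  by have [i _] := crossingP cr; exact: leq_ltn_trans (ltn_ord i).
have := unsaturated_cumulant_sum n0 cP.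
rewrite (bigD1 P) ?lexx //= [X in _ + X]big1 => [|Q /andP[QP nQP]].
  rewrite addr0 big1 ?mulr1 // => s _.
  have [i ri] := run_attained n0 s.
  by rewrite -ri (negPf (unsat i)) subr0.
have [nc|cQ] := pselect (noncrossing Q); last first.
  rewrite IH ?mul0r //; apply: leq_trans PN; apply: proper_card.
  apply/properP; split; last first.
    exists P; rewrite inE ?lexx //; apply: contra nQP => PQ.
    by rewrite eq_le QP.
  by apply/fintype.subsetP => S; rewrite !inE => /le_trans; exact.
have cQ : colors_blocks c Q.
  by move=> i j /(finerP _ _ QP); exact: cP.
have [i sat] := saturated_exists n0 nc cQ.
have ri : (run c i < (run c n.-1).+1)%N.
  by rewrite ltnS leq_run // -ltnS prednK.
by rewrite (bigD1 (Ordinal ri)) //= sat subrr mul0r mulr0.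
Qed.

End CrossingCumulants.
End Exchangeability.

(** * Alternating words of tail-null letters *)

Section AlternatingWords.
Context (R : realType) (A : ncprob R) (E : exch_system A).

(** The condition of the singleton axiom. It says that the conditional expectation
    of the copies of [X] onto the tail algebra would vanish. *)
Definition tail_null (X : A) : Prop := st E (star (cpy E 0 X) * cpy E 1 X) = 0.

Hypothesis hsingle : weak_singleton E.

Lemma singleton_cumulant_eq0 n (Q : setpart n) (X : 'I_n -> A) (i : 'I_n) :
  (forall l, same_block Q i l -> l = i) -> tail_null (X i) ->
  cumulant E Q X = 0.
Proof.
move=> sing Xi; apply: big1 => P PQ; rewrite [moment _ _ _](_ : _ = 0) ?mul0r //.
apply: (hsingle (j := i)) => // k /eqP; rewrite block_num_eq same_block_sym.
by move=> /(finerP _ _ PQ); exact: sing.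
Qed.

Hypothesis hfree : weak_freeness E.

(** Only noncrossing partitions contribute, by [crossing_cumulant_eq0]. In such a
    partition the second letter is either alone in its block or linked to a later
    one, and then a letter between them is alone. The isolated letter is never an
    outer one, so it is tail-null and the cumulant vanishes by the singleton
    condition. *)
Lemma padded_alternating_eq0 n (X : 'I_n.+3 -> A) (h : 'I_n.+3 -> nat) :
  (forall i k : 'I_n.+3, k = i.+1 :> nat -> h i <> h k) ->
  (forall i : 'I_n.+3, (0 < i < n.+2)%N -> tail_null (X i)) ->
  st E (\prod_(i < n.+3) cpy E (h i) (X i)) = 0.
Proof.
move=> alt nullX; rewrite st_moment moment_cumulant big1 // => Q Qh.
have [nc|cQ] := pselect (noncrossing Q); last exact: crossing_cumulant_eq0.
have adj (a b : 'I_n.+3) : b = a.+1 :> nat -> ~~ same_block Q a b.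
  move=> /alt hab; apply/negP => /(finerP _ _ Qh).
  by rewrite same_block_kernel => /eqP.
pose i1 : 'I_n.+3 := lift ord0 ord0.
suff [j jb sing] : exists2 j : 'I_n.+3, (0 < j < n.+2)%N &
    forall l, same_block Q j l -> l = j.
  by apply: singleton_cumulant_eq0 sing _; exact: nullX.
have [sing|/existsNP[k /not_implyP[s1k /eqP k1]]] :=
    pselect (forall l, same_block Q i1 l -> l = i1); first by exists i1.
have [k0|k_gt0] := posnP k.
  have := adj k i1; rewrite k0 same_block_sym s1k.
  by move=> /(_ erefl).
have lt1k : (i1 < k)%N.
  by rewrite ltn_neqAle k_gt0 andbT; apply: contra k1 => /eqP ek; apply/eqP/val_inj.
have [j [/andP[lj jk] sing]] := singleton_between nc adj s1k lt1k.
by exists j => //; rewrite (leq_trans jk) ?andbT ?(ltn_trans _ lj) // -ltnS.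
Qed.

Lemma conjugated_alternating_eq0 n (X : 'I_n.+1 -> A) (h : 'I_n.+1 -> nat)
    (q : nat) (Y Z : A) :
  (forall i k : 'I_n.+1, k = i.+1 :> nat -> h i <> h k) ->
  (forall i, tail_null (X i)) -> (forall i, h i < q)%N ->
  st E (cpy E q Y * \prod_(i < n.+1) cpy E (h i) (X i) * cpy E q Z) = 0.
Proof.
move=> alt nullX hq.
(* The word framed by its two outer letters, for letters and for indices. *)
pose pad T (y z : T) (x : 'I_n.+1 -> T) (i : 'I_n.+3) :=
  if i == 0 :> nat then y else if i == n.+2 :> nat then z else x (inord i.-1).
have padS T (y z : T) x (i : 'I_n.+1) :
    pad T y z x (widen_ord (leqnSn n.+2) (lift ord0 i)) = x i.
  by rewrite /pad /= /bump /= add1n eqSS ltn_eqF ?ltn_ord //= inord_val.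
have padM T (y z : T) x (i : 'I_n.+3) : (0 < i < n.+2)%N ->
    pad T y z x i = x (inord i.-1).
  by move=> /andP[i0 ni]; rewrite /pad gtn_eqF // ltn_eqF.
have := @padded_alternating_eq0 n (pad _ Y Z X) (pad _ q q h).
rewrite big_ord_recr big_ord_recl /=.
have -> : pad _ Y Z X ord_max = Z by rewrite /pad /= eqxx.
have -> : pad _ q q h ord_max = q by rewrite /pad /= eqxx.
under eq_bigr do rewrite !padS.
apply=> [i k ki|i i_in]; last by rewrite padM //; exact: nullX.
have := ltn_ord k; rewrite ki ltnS => ni.
have hqi := hq (inord i.-1); have hqk := hq (inord k.-1).
rewrite ki /= in hqk; rewrite /pad ki /= (ltn_eqF ni).
have [i0|i0] := posnP i.
  by case: eqP => [|_]; [rewrite i0|move=> e; rewrite -e ltnn in hqk].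
case: eqP => [|/eqP kn]; first by move=> _ e; rewrite e ltnn in hqi.
have kn1 : (i < n.+1)%N by rewrite -ltnS ltn_neqAle kn.
by apply: alt; rewrite !inordK ?prednK // (leq_ltn_trans (leq_pred _)).
Qed.

Lemma alternating_eq0 n (X : 'I_n.+1 -> A) (h : 'I_n.+1 -> nat) :
  (forall i k : 'I_n.+1, k = i.+1 :> nat -> h i <> h k) ->
  (forall i, tail_null (X i)) ->
  st E (\prod_(i < n.+1) cpy E (h i) (X i)) = 0.
Proof.
move=> alt nullX.
have := @conjugated_alternating_eq0 n X h (\max_i h i).+1 1 1 alt nullX.
rewrite rmorph1 mul1r mulr1; apply=> i.
by rewrite ltnS; exact: (leq_bigmax i).
Qed.

End AlternatingWords.

(** * Limits of complex sequences *)

Section ComplexLimits.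
Context (R : realType).
Implicit Types (u w : nat -> R[i]) (z l k : R[i]).

Definition tends u l : Prop :=
  forall e : R, 0 < e -> exists N0, forall N, (N0 <= N)%N -> `|u N - l| <= e%:C.

Lemma norm_complexE z : exists2 r : R, 0 <= r & `|z| = r%:C.
Proof.
have := normr_ge0 z; have /complex_realP[r rE] := normr_real z.
by rewrite rE ler0c; exists r.
Qed.

Lemma norm_le_eq0 z : (forall e : R, 0 < e -> `|z| <= e%:C) -> z = 0.
Proof.
have [r r0 rE] := norm_complexE z; rewrite rE => zle; apply/eqP.
rewrite -normr_eq0 rE -[0]/(0%:C) (inj_eq (@complexI R)) eq_le r0 andbT.
by apply/ler_addgt0Pr => e e0; rewrite add0r -lecR zle.
Qed.

Lemma tends_eventually u l (N0 : nat) :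
  (forall N, (N0 <= N)%N -> u N = l) -> tends u l.
Proof.
by move=> ul e e0; exists N0 => N /ul->; rewrite subrr normr0 ler0c ltW.
Qed.

Lemma tends_unique u l k : tends u l -> tends u k -> l = k.
Proof.
move=> ul uk; apply/eqP; rewrite -subr_eq0; apply/eqP/norm_le_eq0 => e e0.
have e2 : 0 < e / 2 by rewrite divr_gt0.
have [N1 h1] := ul _ e2; have [N2 h2] := uk _ e2.
have {h1} := h1 _ (leq_maxl N1 N2); have {h2} := h2 _ (leq_maxr N1 N2).
set z := u _ => h2 h1; rewrite -[l - k](subrKA z) [e]splitr rmorphD /=.
apply: le_trans (ler_normD _ _) _; apply: lerD => //.
by rewrite distrC.
Qed.

Lemma tendsD u w l k : tends u l -> tends w k -> tends (fun N => u N + w N) (l + k).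
Proof.
move=> ul wk e e0; have e2 : 0 < e / 2 by rewrite divr_gt0.
have [N1 h1] := ul _ e2; have [N2 h2] := wk _ e2.
exists (maxn N1 N2) => N; rewrite geq_max => /andP[/h1 {}h1 /h2 {}h2].
rewrite opprD addrACA [e]splitr rmorphD /=.
by apply: le_trans (ler_normD _ _) _; exact: lerD.
Qed.

Lemma tendsZ (c : R[i]) u l : tends u l -> tends (fun N => c * u N) (c * l).
Proof.
move=> ul e e0; have [r r0 rE] := norm_complexE c.
have r1 : 0 < r + 1 by rewrite ltr_wpDl.
have [N0 h0] := ul (e / (r + 1)) (divr_gt0 e0 r1); exists N0 => N /h0 {}h0.
rewrite -mulrBr normrM rE.
apply: le_trans (ler_wpM2l _ h0) _; first by rewrite ler0c.
rewrite -rmorphM /= lecR mulrCA ler_piMr ?(ltW e0) //.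
by rewrite ler_pdivrMr // mul1r; lra.
Qed.

Lemma tends_norm_le u l b : (forall N, `|u N| <= b) -> tends u l -> `|l| <= b.
Proof.
move=> ub ul; have [r r0 rE] := norm_complexE l.
have bE : b = (complex.Re b)%:C.
  have /RRe_real-> // : b \is Num.real.
  by rewrite realE (le_trans (normr_ge0 _) (ub 0%N)).
rewrite rE bE lecR; apply/ler_addgt0Pr => e e0.
have [N0 /(_ _ (leqnn _)) h0] := ul _ e0.
rewrite -lecR rmorphD /= -rE -bE -[l](subKr (u N0)).
apply: le_trans (ler_normB _ _) _; exact: lerD.
Qed.

Lemma normc_i : `|'i%C : R[i]| = 1.
Proof. by rewrite normc_def /= expr0n expr1n add0r sqrtr1. Qed.

Lemma normc_ge_Im z : `|complex.Im z|%:C <= `|z|.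
Proof.
rewrite -normrN -ReiNIm; apply: le_trans (normc_ge_Re _) _.
by rewrite normrM normc_i mulr1.
Qed.

Lemma tends_ge0 u l : (forall N, 0 <= u N) -> tends u l -> 0 <= l.
Proof.
move=> u0 ul; rewrite lecE /=; apply/andP; split.
  rewrite -normr_eq0 eq_le normr_ge0 andbT; apply/ler_addgt0Pr => e e0.
  have [N0 /(_ _ (leqnn _)) h0] := ul _ e0.
  rewrite add0r -lecR; apply: le_trans h0.
  apply: le_trans (normc_ge_Im _); rewrite lecR.
  by case: (u N0) (ger0_Im (u0 N0)) => a b /= ->; case: (l) => c d /=; rewrite add0r normrN.
apply/ler_addgt0Pr => e e0.
have [N0 /(_ _ (leqnn _)) h0] := ul _ e0.
have := le_trans (normc_ge_Re _) h0; rewrite lecR ler_norml.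
move: (u0 N0); rewrite lecE => /andP[_].
by case: (u N0) => a b; case: (l) => c d /=; lra.
Qed.

(** The limit is the supremum of the eventual lower bounds. *)
Lemma real_cauchy (u : nat -> R) :
  (forall e : R, 0 < e -> exists N0, forall N M, (N0 <= N)%N -> (N0 <= M)%N ->
     `|u N - u M| <= e) ->
  exists l : R, forall e : R, 0 < e -> exists N0, forall N, (N0 <= N)%N ->
     `|u N - l| <= e.
Proof.
move=> cau; pose S := [set a | exists N0, forall N, (N0 <= N)%N -> a <= u N].
have bnd e : 0 < e -> exists N0, [/\ S (u N0 - e), ubound S (u N0 + e) &
    forall N, (N0 <= N)%N -> `|u N - u N0| <= e].
  move=> e0; have [N0 h0] := cau e e0; exists N0; split.
  - exists N0 => N NN; have := h0 _ _ NN (leqnn _).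
    by rewrite ler_norml; lra.
  - move=> a [N1 h1]; have := h1 _ (leq_maxl N1 N0).
    have := h0 _ _ (leq_maxr N1 N0) (leqnn _); rewrite ler_norml; lra.
  - by move=> N NN; exact: h0.
have [N1 [S1 ub1 _]] := bnd 1 ltr01.
exists (sup S) => e e0; have e2 : 0 < e / 2 by rewrite divr_gt0.
have [N0 [S0 ub0 h0]] := bnd _ e2; exists N0 => N /h0.
have := ge_sup (ex_intro _ _ S0) ub0.
have : u N0 - e / 2 <= sup S by apply: ub_le_sup S0; exists (u N0 + e / 2).
by rewrite !ler_norml; lra.
Qed.

(** The complex plane inherits completeness from the real line, one coordinate at
    a time. *)
Lemma tends_cauchy u :
  (forall e : R, 0 < e -> exists N0, forall N M, (N0 <= N)%N -> (N0 <= M)%N ->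
     `|u N - u M| <= e%:C) ->
  exists l, tends u l.
Proof.
move=> cau.
have [|a ha] := @real_cauchy (fun N => complex.Re (u N)).
  move=> e /cau[N0 h0]; exists N0 => N M NN MM; rewrite -lecR.
  apply: le_trans (h0 _ _ NN MM); apply: le_trans (normc_ge_Re _).
  by case: (u N) (u M) => ? ? [? ?].
have [|b hb] := @real_cauchy (fun N => complex.Im (u N)).
  move=> e /cau[N0 h0]; exists N0 => N M NN MM; rewrite -lecR.
  apply: le_trans (h0 _ _ NN MM); apply: le_trans (normc_ge_Im _).
  by case: (u N) (u M) => ? ? [? ?].
exists (a +i* b) => e e0; have e2 : 0 < e / 2 by rewrite divr_gt0.
have [N1 h1] := ha _ e2; have [N2 h2] := hb _ e2.
exists (maxn N1 N2) => N; rewrite geq_max => /andP[/h1 {}h1 /h2 {}h2].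
rewrite [_ - _]complexE [e]splitr rmorphD /=.
apply: le_trans (ler_normD _ _) _; rewrite normrM.
have normR (x : R) : `|x%:C| = `|x|%:C.
  by rewrite normc_def /= expr0n addr0 sqrtr_sqr.
rewrite normc_i mul1r !normR; apply: lerD; rewrite lecR.
  by move: h1; case: (u N).
by move: h2; case: (u N).
Qed.

End ComplexLimits.

(** * Positive functionals and states *)

Section PreCstar.
Context (R : realType) (U : preCstarType R).
Implicit Types (x y : U) (c : R[i]).

Lemma cnorm0 : cnorm (0 : U) = 0.
Proof.
apply: (@complexI R); have := cnormZ 0 (0 : U).
by rewrite scale0r normr0 mul0r.
Qed.

Lemma cnormN x : cnorm (- x) = cnorm x.
Proof.
apply: (@complexI R); have := cnormZ (-1) x.
by rewrite scaleN1r normrN1 mul1r.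
Qed.

Lemma cnorm_ge0 x : 0 <= cnorm x.
Proof.
by have := cnormD x (- x); rewrite subrr cnorm0 cnormN; lra.
Qed.

Lemma star0 : star (0 : U) = 0.
Proof. by have := star_linear (-1) (0 : U) 0; rewrite rmorphN rmorph1 !scaleN1r !addNr. Qed.

Lemma starD x y : star (x + y) = star x + star y.
Proof. by have := star_linear 1 x y; rewrite rmorph1 !scale1r. Qed.

Lemma starZ c x : star (c *: x) = Num.conj c *: star x.
Proof. by have := star_linear c x 0; rewrite star0 !addr0. Qed.

Lemma starN x : star (- x) = - star x.
Proof. by rewrite -scaleN1r starZ rmorphN rmorph1 scaleN1r. Qed.

Lemma star1 : star (1 : U) = 1.
Proof.
by have := starM (star 1) (1 : U); rewrite mulr1 !starK mulr1 => <-.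
Qed.

Lemma cnorm1 : cnorm (1 : U) = 1.
Proof.
have := cnorm_star (1 : U); rewrite star1 mulr1 => /eqP.
rewrite expr2 -{1}[cnorm 1]mulr1 -subr_eq0 -mulrBr mulf_eq0 => /orP[/eqP/cnorm_eq0|].
  by move/eqP; rewrite oner_eq0.
by rewrite subr_eq0 => /eqP.
Qed.

Lemma cnorm_scalar c : (cnorm (c%:A : U))%:C = `|c|.
Proof. by rewrite cnormZ cnorm1 mulr1. Qed.

Lemma cnorm_starE x : cnorm (star x) = cnorm x.
Proof.
suff le y : cnorm y <= cnorm (star y).
  by apply/eqP; rewrite eq_le le -{2}[x]starK le.
have := cnormM (star y) y; rewrite cnorm_star expr2.
have := cnorm_ge0 y; rewrite le_eqVlt => /predU1P[<- _|y0].
  exact: cnorm_ge0.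
by rewrite ler_pM2r.
Qed.

End PreCstar.

Section PositiveFunctionals.
Context (R : realType) (U : preCstarType R) (f : U -> R[i]).
Hypothesis flin : linear_for *%R f.
Hypothesis fpos : forall x, 0 <= f (star x * x).

#[local] HB.instance Definition _ := GRing.isLinear.Build R[i] U R[i] *%R f flin.

Lemma positive_star x : f (star x) = Num.conj (f x).
Proof.
have imE (c : R[i]) : Num.conj c * f x + c * f (star x) \is Num.real.
  have := ger0_real (fpos (x + c%:A)).
  have -> : f (star (x + c%:A) * (x + c%:A)) =
      f (star x * x) + `|c| ^+ 2 * f 1 + (Num.conj c * f x + c * f (star x)).
    rewrite starD starZ star1 mulrDr !mulrDl !mulr_algl !mulr_algr scalerA.
    rewrite !(linearD, linearZ) /= normCK; ring.
  have r1 : f (star x * x) + `|c| ^+ 2 * f 1 \is Num.real.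
    rewrite realD ?ger0_real // mulr_ge0 ?exprn_ge0 //.
    by have := fpos 1; rewrite star1 mulr1.
  by rewrite (rpredDl _ r1).
have := imE 1; have := imE 'i.
rewrite rmorph1 !mul1r -[Num.conj _]/(0 -i* 1) -[Num.conj (f x)]/((f x)^*).
case: (f x) (f (star x)) => a b [c d]; simpc.
rewrite !complex_real => /eqP ac /eqP bd.
by apply/eqP; rewrite eq_complex /=; apply/andP; split; apply/eqP; lra.
Qed.

Hypothesis f1 : f 1 = 1.

Lemma positive_cauchy_schwarz x : `|f x| ^+ 2 <= f (star x * x).
Proof.
rewrite -subr_ge0; apply: le_trans (fpos (x - (f x)%:A)) _.
rewrite starD starN starZ star1 mulrDl !mulrBr !mulNr.
rewrite !mulr_algl !mulr_algr scalerA.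
rewrite !(linearB, linearD, linearN, linearZ) /= f1 positive_star normCK.
by rewrite le_eqVlt; apply/orP; left; apply/eqP; rewrite /GRing.scale /=; ring.
Qed.

(** Each application of Cauchy-Schwarz replaces [x] by [star x * x], which squares
    the norm but leaves the constant [C] alone. *)
Lemma positive_norm_pow (C : R) : (forall x, `|f x| <= (C * cnorm x)%:C) ->
  forall n x, `|f x| ^+ (2 ^ n) <= (C * cnorm x ^+ (2 ^ n))%:C.
Proof.
move=> fC; elim=> [|n IH] x; first by rewrite !expr1.
rewrite expnS !exprM; apply: le_trans (_ : `|f (star x * x)| ^+ (2 ^ n) <= _).
  rewrite lerXn2r ?nnegrE ?exprn_ge0 // (ger0_norm (fpos x)).
  exact: positive_cauchy_schwarz.
by rewrite -cnorm_star.
Qed.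

(** The constant disappears in the limit of the [2 ^ n]-th roots. *)
Lemma positive_contractive (C : R) : (forall x, `|f x| <= (C * cnorm x)%:C) ->
  forall x, `|f x| <= (cnorm x)%:C.
Proof.
move=> /positive_norm_pow fC x; have [r r0 rE] := norm_complexE (f x).
have {}fC n : r ^+ (2 ^ n) <= C * cnorm x ^+ (2 ^ n).
  by rewrite -lecR rmorphXn /= -rE.
rewrite rE lecR leNgt; apply/negP => xr.
have := cnorm_ge0 x; rewrite le_eqVlt => /predU1P[x0|x0].
  by have := fC 0%N; rewrite -x0 expr1 mulr0; lra.
pose q := r / cnorm x - 1.
have q0 : 0 < q by rewrite subr_gt0 ltr_pdivlMr // mul1r.
have qC n : q *+ n <= C.
  apply: le_trans (_ : (1 + q) ^+ (2 ^ n) <= C).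
    have bern k : 1 + q *+ k <= (1 + q) ^+ k.
      elim: k => [|k IH]; first by rewrite addr0.
      rewrite exprS; apply: le_trans (ler_wpM2l _ IH); last by lra.
      rewrite mulrDl mul1r mulrDr mulr1 mulrSr.
      have : 0 <= q * (q *+ k) by rewrite mulr_ge0 ?mulrn_wge0 // ltW.
      lra.
    apply: le_trans (bern _).
    have : q *+ n <= q *+ 2 ^ n.
      rewrite -(mulr_natr q n) -(mulr_natr q (2 ^ n)%N) ler_wpM2l ?(ltW q0) //.
      by rewrite ler_nat ltnW // ltn_expl.
    lra.
  rewrite /q [1 + _]addrC subrK expr_div_n ler_pdivrMr ?exprn_gt0 //.
have C0 : 0 <= C by have := qC 0%N; rewrite mulr0n.
have := archi_boundP (divr_ge0 C0 (ltW q0)).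
by rewrite ltr_pdivrMr // mulr_natl ltNge qC.
Qed.

(** A normalized positive functional is contractive as soon as it is bounded. The
    bound is a genuine hypothesis, as [U] need not be complete. *)
Lemma positive_is_state (C : R) : (forall x, `|f x| <= (C * cnorm x)%:C) ->
  is_state_on [set: U] f.
Proof.
move=> fC; split=> //; last by move=> x _; exact: positive_contractive fC x.
by move=> c x y _ _; exact: flin.
Qed.

End PositiveFunctionals.

(** States are contractive, hence equicontinuous: convergence on a dense set
    extends to the whole algebra. *)
Lemma state_limit (R : realType) (U : preCstarType R) (G : set U)
    (f : nat -> U -> R[i]) :
  (forall N, is_state_on [set: U] (f N)) -> norm_closure G = [set: U] ->
  (forall y, G y -> exists N0 l, forall N, (N0 <= N)%N -> f N y = l) ->
  exists2 F, is_state_on [set: U] F & forall x, tends (f ^~ x) (F x).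
Proof.
move=> fst dense evt.
have flin N (c : R[i]) x y : f N (c *: x + y) = c * f N x + f N y.
  by have [L _ _ _] := fst N; exact: L.
have fbd N x : `|f N x| <= (cnorm x)%:C by have [_ _ _ B] := fst N; exact: B.
have fB N x y : f N (x - y) = f N x - f N y.
  by rewrite addrC -scaleN1r flin mulN1r addrC.
have cvg x : exists l, tends (f ^~ x) l.
  apply: tends_cauchy => e e0.
  have : norm_closure G x by rewrite dense.
  move=> /(_ _ (divr_gt0 e0 (ltr0n _ 2)))[y Gy xy].
  have [N0 [l fl]] := evt y Gy; exists N0 => N M NN MM.
  have -> : f N x - f M x = f N (x - y) - f M (x - y).
    by rewrite !fB !fl //; ring.
  apply: le_trans (ler_normB _ _) _; rewrite [e]splitr rmorphD /=.
  by apply: lerD; apply: le_trans (fbd _ _) _; rewrite lecR ltW.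
have [F FE] := choice cvg; exists F => //; split.
- move=> c x y _ _; apply: tends_unique (FE _) _.
  have := tendsD (tendsZ c (FE x)) (FE y).
  by congr tends; apply/funext => N; rewrite flin.
- apply: tends_unique (FE 1) _; apply: (@tends_eventually _ _ _ 0) => N _.
  by have [_ -> _ _] := fst N.
- move=> x _; apply: tends_ge0 (FE _) => N.
  by have [_ _ P _] := fst N; exact: P.
- by move=> x _; apply: tends_norm_le (FE x) => N; exact: fbd.
Qed.

Lemma conjugated_state (R : realType) (U : ncprob R) (w : U) :
  st U (star w * w) != 0 ->
  is_state_on [set: U] (fun x => st U (star w * x * w) / st U (star w * w)).
Proof.
move=> nz; have [_ _ pos bd] := stP U.
have a0 : 0 < st U (star w * w) by rewrite lt0r nz pos.
have [a a_ge0 aE] := norm_complexE (st U (star w * w)).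
rewrite (ger0_norm (ltW a0)) in aE.
apply: (@positive_is_state _ _ _ _ _ _ (a^-1 * (cnorm (star w) * cnorm w))).
- move=> c x y; rewrite mulrDr mulrDl -scalerAr -scalerAl.
  by rewrite linearD linearZ /= mulrDl mulrA.
- move=> x; apply: divr_ge0 (ltW a0).
  have -> : star w * (star x * x) * w = star (x * w) * (x * w).
    by rewrite starM !mulrA.
  exact: pos.
- by rewrite mulr1 divff.
move=> x; rewrite normrM normfV (ger0_norm (ltW a0)) aE mulrC.
have -> : (a%:C)^-1 = a^-1%:C by rewrite [RHS]fmorphV.
rewrite -(mulrA a^-1) rmorphM; apply: ler_wpM2l.
  by rewrite ler0c invr_ge0.
apply: le_trans (bd _ I) _; rewrite lecR.
apply: le_trans (cnormM _ _) _; rewrite mulrAC.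
by apply: ler_wpM2r (cnormM _ _); exact: cnorm_ge0.
Qed.

(** * Bounded functions and evaluation by a family of states *)

Section BoundedFunctions.
Context (R : realType) (U : preCstarType R) (K : Type) (k0 : K).

Definition bounded (f : K -> U) : Prop := exists M, forall k, cnorm (f k) <= M.

(** The parameter witnesses that [K] is inhabited, which makes the algebra of
    bounded functions nonzero. *)
Record bounded_fun (k : K) := BFun { bval :> K -> U; bvalP : bounded bval }.

Local Notation V := (bounded_fun k0).
Implicit Types f g h : V.

Lemma bfunP f g : (forall k, f k = g k) -> f = g.
Proof.
case: f g => f fb [g gb] /= fg; have {}fg : f = g by exact: funext.
by subst g; congr BFun; exact: Prop_irrelevance.
Qed.

HB.instance Definition _ := gen_eqMixin V.
HB.instance Definition _ := gen_choiceMixin V.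

Lemma bounded_cst (x : U) : bounded (fun=> x).
Proof. by exists (cnorm x). Qed.

Lemma bounded_opp f : bounded (fun k => - f k).
Proof. by have [M fM] := bvalP f; exists M => k; rewrite cnormN. Qed.

Lemma bounded_add f g : bounded (fun k => f k + g k).
Proof.
have [M fM] := bvalP f; have [N gN] := bvalP g; exists (M + N) => k.
by apply: le_trans (cnormD _ _) _; exact: lerD.
Qed.

Lemma bounded_mul f g : bounded (fun k => f k * g k).
Proof.
have [M fM] := bvalP f; have [N gN] := bvalP g; exists (M * N) => k.
apply: le_trans (cnormM _ _) _; apply: ler_pM => //; exact: cnorm_ge0.
Qed.

Lemma cnormZ_real (c : R[i]) : exists2 r : R, 0 <= r &
  `|c| = r%:C /\ forall x : U, cnorm (c *: x) = r * cnorm x.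
Proof.
have [r r0 rE] := norm_complexE c; exists r => //; split=> // x.
by apply: (@complexI R); rewrite cnormZ rE rmorphM.
Qed.

Lemma bounded_scale (c : R[i]) f : bounded (fun k => c *: f k).
Proof.
have [M fM] := bvalP f; have [r r0 [_ rE]] := cnormZ_real c.
by exists (r * M) => k; rewrite rE ler_wpM2l.
Qed.

Lemma bounded_star f : bounded (fun k => star (f k)).
Proof. by have [M fM] := bvalP f; exists M => k; rewrite cnorm_starE. Qed.

Definition bcst x : V := @BFun k0 _ (bounded_cst x).
Definition bopp f : V := @BFun k0 _ (bounded_opp f).
Definition badd f g : V := @BFun k0 _ (bounded_add f g).
Definition bmul f g : V := @BFun k0 _ (bounded_mul f g).
Definition bscale c f : V := @BFun k0 _ (bounded_scale c f).
Definition bstar f : V := @BFun k0 _ (bounded_star f).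

Fact baddA : associative badd.
Proof. by move=> f g h; apply: bfunP => k /=; rewrite addrA. Qed.
Fact baddC : commutative badd.
Proof. by move=> f g; apply: bfunP => k /=; rewrite addrC. Qed.
Fact badd0 : left_id (bcst 0) badd.
Proof. by move=> f; apply: bfunP => k /=; rewrite add0r. Qed.
Fact baddN : left_inverse (bcst 0) bopp badd.
Proof. by move=> f; apply: bfunP => k /=; rewrite addNr. Qed.
HB.instance Definition _ := GRing.isZmodule.Build V baddA baddC badd0 baddN.

Fact bmulA : associative bmul.
Proof. by move=> f g h; apply: bfunP => k /=; rewrite mulrA. Qed.
Fact bmul1 : left_id (bcst 1) bmul.
Proof. by move=> f; apply: bfunP => k /=; rewrite mul1r. Qed.
Fact bmulr1 : right_id (bcst 1) bmul.
Proof. by move=> f; apply: bfunP => k /=; rewrite mulr1. Qed.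
Fact bmulDl : left_distributive bmul +%R.
Proof. by move=> f g h; apply: bfunP => k /=; rewrite mulrDl. Qed.
Fact bmulDr : right_distributive bmul +%R.
Proof. by move=> f g h; apply: bfunP => k /=; rewrite mulrDr. Qed.
Fact bone_neq0 : bcst 1 != 0.
Proof.
by apply/eqP => /(congr1 (fun f : V => f k0)) /= /eqP; rewrite oner_eq0.
Qed.
HB.instance Definition _ := GRing.Zmodule_isNzRing.Build V
  bmulA bmul1 bmulr1 bmulDl bmulDr bone_neq0.

Fact bscaleA (c d : R[i]) f : bscale c (bscale d f) = bscale (c * d) f.
Proof. by apply: bfunP => k /=; rewrite scalerA. Qed.
Fact bscale1 : left_id 1 bscale.
Proof. by move=> f; apply: bfunP => k /=; rewrite scale1r. Qed.
Fact bscaleDr : right_distributive bscale +%R.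
Proof. by move=> c f g; apply: bfunP => k /=; rewrite scalerDr. Qed.
Fact bscaleDl f : {morph bscale^~ f : c d / c + d}.
Proof. by move=> c d; apply: bfunP => k /=; rewrite scalerDl. Qed.
HB.instance Definition _ := GRing.Zmodule_isLmodule.Build R[i] V
  bscaleA bscale1 bscaleDr bscaleDl.

Fact bscaleAl (c : R[i]) f g : c *: (f * g) = c *: f * g.
Proof. by apply: bfunP => k /=; rewrite scalerAl. Qed.
HB.instance Definition _ := GRing.Lmodule_isLalgebra.Build R[i] V bscaleAl.

Fact bscaleAr (c : R[i]) f g : c *: (f * g) = f * (c *: g).
Proof. by apply: bfunP => k /=; rewrite scalerAr. Qed.
HB.instance Definition _ := GRing.Lalgebra_isAlgebra.Build R[i] V bscaleAr.

Definition bnorm f : R := sup (range (fun k => cnorm (f k))).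

Lemma le_bnorm f k : cnorm (f k) <= bnorm f.
Proof.
apply: ub_le_sup; last by exists k.
by have [M fM] := bvalP f; exists M => _ [l _ <-].
Qed.

Lemma bnorm_le f M : (forall k, cnorm (f k) <= M) -> bnorm f <= M.
Proof.
move=> fM; apply: ge_sup; first by exists (cnorm (f k0)), k0.
by move=> _ [l _ <-].
Qed.

Lemma bnorm_ge0 f : 0 <= bnorm f.
Proof. exact: le_trans (cnorm_ge0 _) (le_bnorm f k0). Qed.

Fact bstarK : involutive bstar.
Proof. by move=> f; apply: bfunP => k /=; rewrite starK. Qed.
Fact bstar_linear (c : R[i]) f g :
  bstar (c *: f + g) = Num.conj c *: bstar f + bstar g.
Proof. by apply: bfunP => k /=; rewrite star_linear. Qed.
Fact bstarM f g : bstar (f * g) = bstar g * bstar f.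
Proof. by apply: bfunP => k /=; rewrite starM. Qed.
Fact bnorm_eq0 f : bnorm f = 0 -> f = 0.
Proof.
move=> f0; apply: bfunP => k; apply: cnorm_eq0; apply/eqP.
by rewrite eq_le cnorm_ge0 -{1}f0 le_bnorm.
Qed.
Fact bnormD f g : bnorm (f + g) <= bnorm f + bnorm g.
Proof.
apply: bnorm_le => k; apply: le_trans (cnormD _ _) _.
by apply: lerD; exact: le_bnorm.
Qed.
Fact bnormZ (c : R[i]) f : (bnorm (c *: f))%:C = `|c| * (bnorm f)%:C.
Proof.
have [r r0 [-> rE]] := cnormZ_real c; rewrite -rmorphM; congr (_%:C).
apply/eqP; rewrite eq_le; apply/andP; split.
  by apply: bnorm_le => k; rewrite /= rE ler_wpM2l // le_bnorm.
have [->|nr] := eqVneq r 0; first by rewrite mul0r bnorm_ge0.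
have {nr}r0 : 0 < r by rewrite lt0r nr.
rewrite mulrC -ler_pdivlMr //; apply: bnorm_le => k.
by rewrite ler_pdivlMr // mulrC -rE; exact: (le_bnorm (c *: f)).
Qed.
Fact bnormM f g : bnorm (f * g) <= bnorm f * bnorm g.
Proof.
apply: bnorm_le => k; apply: le_trans (cnormM _ _) _.
by apply: ler_pM; rewrite ?cnorm_ge0 ?le_bnorm.
Qed.
Fact bnorm_star f : bnorm (bstar f * f) = bnorm f ^+ 2.
Proof.
apply/eqP; rewrite eq_le; apply/andP; split.
  apply: bnorm_le => k; rewrite /= cnorm_star.
  by rewrite lerXn2r ?nnegrE ?cnorm_ge0 ?bnorm_ge0 ?le_bnorm.
rewrite -[leRHS]sqr_sqrtr ?bnorm_ge0 // lerXn2r ?nnegrE ?bnorm_ge0 ?sqrtr_ge0 //.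
apply: bnorm_le => k; rewrite -[leLHS]ger0_norm ?cnorm_ge0 // -sqrtr_sqr.
by rewrite ler_wsqrtr // -cnorm_star; exact: (le_bnorm (bstar f * f)).
Qed.
HB.instance Definition _ := isPreCstar.Build R V
  bstarK bstar_linear bstarM bnorm_eq0 bnormD bnormZ bnormM bnorm_star.

Fact bcst_linear : linear bcst.
Proof. by move=> c x y; apply: bfunP. Qed.
HB.instance Definition _ := GRing.isLinear.Build R[i] U V _ bcst bcst_linear.
Fact bcst_monoid_morphism : monoid_morphism bcst.
Proof. by split=> [|x y]; apply: bfunP. Qed.
HB.instance Definition _ := GRing.isMonoidMorphism.Build U V bcst
  bcst_monoid_morphism.

Section Expectation.
Context (w : K -> U -> R[i]) (wP : forall k, is_state_on [set: U] (w k)).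

Lemma bounded_expectation f : bounded (fun k => (w k (f k))%:A).
Proof.
have [M fM] := bvalP f; exists M => k; apply: le_trans (fM k).
rewrite -lecR cnorm_scalar.
by have [_ _ _ bd] := wP k; exact: bd.
Qed.

(** Each coordinate is integrated against its own state. *)
Definition expectation f : V := @BFun k0 _ (bounded_expectation f).

Definition scalar_valued : set V := [set f | forall k, exists c, f k = c%:A].

Lemma expectation_linear (c : R[i]) f g :
  expectation (c *: f + g) = c *: expectation f + expectation g.
Proof.
apply: bfunP => k /=; have [lin _ _ _] := wP k.
by rewrite lin // scalerDl scalerA.
Qed.

Lemma expectationB f g : expectation (f - g) = expectation f - expectation g.
Proof. by rewrite addrC -scaleN1r expectation_linear scaleN1r addrC. Qed.

Lemma bnorm_expectation f : cnorm (expectation f) <= cnorm f.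
Proof.
apply: bnorm_le => k; rewrite /= -lecR cnorm_scalar.
have [_ _ _ bd] := wP k; apply: le_trans (bd _ I) _.
by rewrite lecR; exact: le_bnorm.
Qed.

Lemma state_scalar k c : w k c%:A = c.
Proof.
have [lin w1 _ _] := wP k.
have w0 : w k 0 = 0 by have := lin (-1) 0 0 I I; rewrite scaler0 add0r mulN1r addNr.
by rewrite -[c%:A]addr0 lin // w1 w0 mulr1 addr0.
Qed.

(** The values are nonnegative scalars and have square roots. *)
Lemma expectation_square g : exists h, expectation (star g * g) = star h * h.
Proof.
have pos k : 0 <= w k (star (g k) * g k) by have [_ _ p _] := wP k; exact: p.
pose s k := sqrtC (w k (star (g k) * g k)).
have sE k : star ((s k)%:A : U) * (s k)%:A = (w k (star (g k) * g k))%:A.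
  rewrite starZ star1 mulr_algl scalerA conj_Creal ?ger0_real ?sqrtC_ge0 //.
  by rewrite -expr2 sqrtCK.
suff sb : bounded (fun k => (s k)%:A).
  by exists (@BFun k0 _ sb); apply: bfunP => k; rewrite /= sE.
have [M gM] := bounded_expectation (star g * g); exists (M + 1) => k.
have := gM k; rewrite /= -sE cnorm_star.
by have := cnorm_ge0 ((s k)%:A : U); nra.
Qed.

Lemma expectation_cond_exp : cond_exp scalar_valued expectation.
Proof.
split.
- split; last first.
    by move=> f fB k; have [c fk] := fB k; exists (Num.conj c);
      rewrite /= fk starZ star1.
  split=> [k|c f g fB gB k|f g fB gB k].
  + by exists 1; rewrite scale1r.
  + have [a fk] := fB k; have [b gk] := gB k; exists (c * a + b).
    by rewrite /= fk gk scalerA -scalerDl.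
  + have [a fk] := fB k; have [b gk] := gB k; exists (a * b).
    by rewrite /= fk gk mulr_algl scalerA.
- exact: expectation_linear.
- apply: bfunP => k /=; have := state_scalar k 1.
  by rewrite scale1r => ->; rewrite scale1r.
- move=> f fpos e e0; have [_ [g _ <-] fg] := fpos e e0.
  have [h hE] := expectation_square g.
  exists (star h * h); first by exists h.
  by rewrite -hE -expectationB; apply: le_lt_trans (bnorm_expectation _) fg.
split.
- apply/seteqP; split=> [_ [f _ <-] k|f fB]; first by exists (w k (f k)).
  exists f => //; apply: bfunP => k /=; have [c ->] := fB k.
  by rewrite state_scalar.
- move=> b f b' bB b'B; apply: bfunP => k /=.
  have [c ->] := bB k; have [c' ->] := b'B k.
  have [lin _ _ _] := wP k.
  have wZ d x : w k (d *: x) = d * w k x.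
    have := state_scalar k 0; rewrite scale0r => w0.
    by have := lin d x 0 I I; rewrite w0 !addr0.
  by rewrite !mulr_algl !mulr_algr !wZ !scalerA mulrA.
Qed.

End Expectation.
End BoundedFunctions.

(** * The embedding *)

Section Embedding.
Context (R : realType) (A : ncprob R) (E : exch_system A).

(** The states which behave on words as the coordinates of the expectation of an
    amalgamated free product onto its tail algebra do. *)
Definition tail_free_state (w : E -> R[i]) : Prop :=
  [/\ is_state_on [set: E] w,
      forall n (X : 'I_n -> A) (h : 'I_n -> nat) (s : nat -> nat), bijective s ->
        w (\prod_(i < n) cpy E (h i) (X i)) =
        w (\prod_(i < n) cpy E (s (h i)) (X i))
    & forall n (X : 'I_n.+1 -> A) (h : 'I_n.+1 -> nat),
        (forall i k : 'I_n.+1, k = i.+1 :> nat -> h i <> h k) ->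
        (forall i, tail_null E (X i)) ->
        w (\prod_(i < n.+1) cpy E (h i) (X i)) = 0].

(** Algebraic elements involve finitely many copies. *)
Lemma finite_support (y : E) :
  gen_subalg (\bigcup_k range (cpy E k)) y ->
  exists M, forall s, bijective s -> (forall k, k < M -> s k = k)%N ->
    act E s y = y.
Proof.
pose S := [set z : E | exists M, forall s, bijective s ->
  (forall k, k < M -> s k = k)%N -> act E s z = z].
move=> /(_ S); apply; split; last first.
  move=> _ [k _ [x _ <-]]; exists k.+1 => s sb sk.
  by rewrite act_cpy // sk.
split=> [|c x z [M xM] [N zN]|x z [M xM] [N zN]].
- by exists 0%N => s _ _; rewrite rmorph1.
- exists (maxn M N) => s sb sMN; rewrite linearP /= xM ?zN // => k kl.
    by rewrite sMN // (leq_trans kl) // leq_maxr.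
  by rewrite sMN // (leq_trans kl) // leq_maxl.
- exists (maxn M N) => s sb sMN; rewrite rmorphM /= xM ?zN // => k kl.
    by rewrite sMN // (leq_trans kl) // leq_maxr.
  by rewrite sMN // (leq_trans kl) // leq_maxl.
Qed.

Hypothesis hsingle : weak_singleton E.
Hypothesis hfree : weak_freeness E.

Lemma tail_free_st : tail_free_state (st E).
Proof.
split; [exact: stP|by move=> n X h s; exact: exchangeable|].
by move=> n X h; exact: alternating_eq0.
Qed.

Lemma st_cpy_square k (v : A) :
  st E (star (cpy E k v) * cpy E k v) = st A (star v * v).
Proof. by rewrite -cpy_star -rmorphM cpy_st. Qed.

(** The state of the universe conjugated by a copy of [v] at infinity. *)
Lemma tilted_state (v : A) : st A (star v * v) != 0 ->
  exists2 w, tail_free_state w & forall X, w (cpy E 0 X) =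
    st E (star (cpy E 1 v) * cpy E 0 X * cpy E 1 v) / st A (star v * v).
Proof.
move=> nz; set a := st A _ in nz *.
pose f N x := st E (star (cpy E N v) * x * cpy E N v) / a.
have fst N : is_state_on [set: E] (f N).
  have := @conjugated_state _ E (cpy E N v); rewrite st_cpy_square; exact.
have fact N M s x : bijective s -> s N = M -> f N x = f M (act E s x).
  move=> sb sN; rewrite /f -(act_st _ sb) !rmorphM /= act_star // !act_cpy //.
  by rewrite sN.
have [|w wst wlim] := state_limit fst (generated E).
  move=> y /finite_support[M yM]; exists M, (f M y) => N MN.
  rewrite (fact N M (swap N M)) ?swapL ?yM //; try exact: swap_bij.
  by move=> k kM; rewrite swap_id ?ltn_eqF // (leq_trans kM).
have wE x N0 l : (forall N, (N0 <= N)%N -> f N x = l) -> w x = l.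
  move=> fx; exact: tends_unique (wlim x) (tends_eventually fx).
exists w; last first.
  move=> X; apply: (wE _ 1%N) => N N1.
  rewrite (fact N 1%N (swap N 1)) ?swapL //; last exact: swap_bij.
  by rewrite act_cpy ?swap_id ?ltn_eqF //; exact: swap_bij.
split=> //.
- move=> n X h s sb.
  pose B := (maxn (\max_i h i) (\max_i s (h i))).+1.
  have hB i : (h i < B)%N.
    by rewrite ltnS leq_max (leq_bigmax i).
  have shB i : (s (h i) < B)%N.
    by rewrite ltnS leq_max (leq_bigmax (F := fun i => s (h i)) i) orbT.
  have fE N M : (B <= N)%N -> (B <= M)%N ->
      f N (\prod_(i < n) cpy E (h i) (X i)) =
      f M (\prod_(i < n) cpy E (s (h i)) (X i)).
    move=> BN BM.
    pose u o := if o is Some i then h i else N.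
    pose u' o := if o is Some i then s (h i) else M.
    have [|t tb tE] := @bijective_extension (option 'I_n) u u'.
      have := hB; have := shB => shB' hB' [i|] [j|] /=; rewrite ?eqxx //.
      - by rewrite (inj_eq (bij_inj sb)).
      - by rewrite !ltn_eqF ?(leq_trans (hB' _)) ?(leq_trans (shB' _)).
      - by rewrite !gtn_eqF ?(leq_trans (hB' _)) ?(leq_trans (shB' _)).
    rewrite (fact N M t) //; last exact: (tE None).
    rewrite rmorph_prod; congr (f M _); apply: eq_bigr => i _.
    by rewrite /= act_cpy // (tE (Some i)).
  rewrite (wE _ B (f B (\prod_(i < n) cpy E (s (h i)) (X i)))).
    by apply/esym/(wE _ B) => N BN; rewrite -(fE B N) // (fE B B).
  by move=> N BN; rewrite (fE N B).
- move=> n X h alt nullX; apply: (wE _ (\max_i h i).+1) => N hN.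
  rewrite /f -cpy_star conjugated_alternating_eq0 ?mul0r // => i.
  by apply: leq_trans hN; rewrite ltnS; exact: (leq_bigmax i).
Qed.

Hypothesis hfaithful : faithful (st E).

(** Polarization: the values at [X] of the states tilted by [c + X], for
    [c = 1, -1, 'i, -'i], combine to [st (star X^(1) * X^(0))]. *)
Lemma tail_null_of_states (X : A) :
  (forall w, tail_free_state w -> w (cpy E 0 X) = 0) -> tail_null E X.
Proof.
move=> wX.
have tilt (v : A) : st E (star (cpy E 1 v) * cpy E 0 X * cpy E 1 v) = 0.
  have [v0|nz] := eqVneq (st A (star v * v)) 0.
    have -> : cpy E 1 v = 0 by apply: hfaithful; rewrite st_cpy_square.
    by rewrite mulr0 raddf0.
  have [w wf wE] := tilted_state nz.
  have := wX w wf; rewrite wE => /eqP; rewrite mulf_eq0 invr_eq0 (negPf nz) orbF.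
  by move/eqP.
set x := cpy E 0 X in tilt *; set y := cpy E 1 X.
have pol (c : R[i]) : `|c| ^+ 2 * st E x + Num.conj c * st E (x * y) +
    c * st E (star y * x) + st E (star y * x * y) = 0.
  have := tilt (c%:A + X); rewrite rmorphD /= linearZ /= rmorph1 -/y.
  rewrite starD starZ star1 !(mulrDl, mulrDr) !(mulr_algl, mulr_algr).
  rewrite -!scalerAl !scalerA !(linearD, linearZ) /= normCK => <-.
  ring.
have p1 := pol 1; have m1 := pol (-1); have pi := pol 'i%C; have mi := pol (- 'i%C).
have ci : Num.conj 'i%C = - 'i%C :> R[i].
  by apply/eqP; rewrite eq_complex /= oppr0 !eqxx.
have i2 : 'i%C * 'i%C = -1 :> R[i] by rewrite -expr2 sqr_i.
rewrite !(normrN, rmorphN, rmorph1) /= ?ci in p1 m1 pi mi.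
have yx0 : st E (star y * x) = 0.
  have four : 4 != 0 :> R[i] by rewrite pnatr_eq0.
  apply: (mulfI four); rewrite mulr0.
  set a := st E x in p1 m1 pi mi; set b := st E (x * y) in p1 m1 pi mi.
  set c := st E (star y * x) in p1 m1 pi mi *.
  set d := st E (star y * x * y) in p1 m1 pi mi.
  have e1 : 2 * (b + c) = 0 by rewrite -[RHS]subr0 -{1}p1 -m1; ring.
  have e2 : 2 * ('i%C * (c - b)) = 0 by rewrite -[RHS]subr0 -{1}pi -mi; ring.
  transitivity (2 * (b + c) - 'i%C * (2 * ('i%C * (c - b)))).
    by rewrite mulrCA [_ * (_ * (c - b))]mulrA i2; ring.
  by rewrite e1 e2 mulr0 subr0.
rewrite /tail_null -(act_st _ (swap_bij 0 1)) rmorphM /=.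
rewrite act_star ?act_cpy; try exact: swap_bij.
by rewrite swapL swapR.
Qed.

(** The coordinate at [st E] is the original state, so that evaluation there is the
    required state on the scalar valued functions. *)
Lemma amalgamated_embedding : embeds_in_amalgamated_free_product E.
Proof.
pose K := {w : E -> R[i] | tail_free_state w}.
pose k0 : K := exist _ _ tail_free_st.
have wP (k : K) : is_state_on [set: E] (sval k) by case: (svalP k).
exists (bounded_fun E k0), (@scalar_valued _ _ _ k0), (expectation wP), (@bcst R E K k0),
  (fun f : bounded_fun E k0 => st E (f k0)).
have jprod n (F : 'I_n -> E) (k : K) :
    (\prod_(i < n) (bcst k0 (F i) : bounded_fun E k0)) k = \prod_(i < n) F i.
  by rewrite -rmorph_prod.
split.
- exact: expectation_cond_exp.
- split=> [x y /(congr1 (fun f : bounded_fun E k0 => f k0))//|x].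
  by apply: bfunP.
- split=> [|x]; last first.
    by rewrite /= linearZ /=; have [_ -> _ _] := stP E; rewrite mulr1.
  have [lin s1 pos bd] := stP E; split=> //.
  + by move=> c f g _ _; exact: lin.
  + by move=> f _; exact: pos.
  + move=> f _; apply: le_trans (bd _ I) _; rewrite lecR; exact: le_bnorm.
- move=> n X h s sb; apply: bfunP => k /=; congr (_ *: _).
  by rewrite !jprod; have [_ ex _] := svalP k; exact: ex.
- move=> n X h psi0 alt; apply: bfunP => k /=; rewrite jprod.
  have [_ _ fr] := svalP k; rewrite (fr _ X h alt) ?scale0r // => i.
  apply: tail_null_of_states => w wf.
  have := congr1 (fun f : bounded_fun E k0 => st E (f (exist _ w wf))) (psi0 i).
  by rewrite /= linearZ /= raddf0; have [_ -> _ _] := stP E; rewrite mulr1.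
Qed.

End Embedding.

Theorem theorem4p3 (R : realType) (A : ncprob R) (E : exch_system A)
    (hfaithful : faithful (st E)) (hfree : weak_freeness E)
    (hsingle : weak_singleton E) :
  (forall (n : nat) (X : 'I_n -> A) (P : setpart n),
      ~ noncrossing P -> cumulant E P X = 0%R) /\
  embeds_in_amalgamated_free_product E.
Proof.
split; last exact: amalgamated_embedding.
by move=> n X P; exact: crossing_cumulant_eq0.
Qed.
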